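(* Let $(E,\mathscr E)$ be a standard Borel space, $X=E^{\mathbb N}$, and let $f$ be a bounded $\alpha$-H\''older continuous normalized potential, i.e. $f\in\mathrm{Hol}(\alpha)$ and $\mathscr L_f(1)=1$. Then the Markov operator $P=\mathscr L_f^*|_{\mathscr M_{\mathrm{fin}}(X)}$ is asymptotically stable. Moreover, there exist $C>0$ and $s\in(0,1)$ such that, where $\nu$ is the unique stationary probability measure of $P$ and $d$ is the Wasserstein metric defined in the context, $$d(P^n(\mu),\nu)\le Cs^n\qquad\text{for all }\mu\in\mathscr M_1(X)\text{ and all } n\in\mathbb N.$$
   Context: $E$ is equipped with a complete separable metric $d_E$ whose Borel sigma-algebra is $\mathscr E$, $p$ is a fixed Borel probability measure on $E$, and $X=E^{\mathbb N}$ has metric $d_X(x,y)=\sum_{n\ge1}2^{-n}\min\{d_E(x_n,y_n),1\}$. $C_b(X,\mathbb R)$ is the space of bounded continuous real functions. For fixed $0<\alpha<1$, $\mathrm{Hol}(\alpha)=\{f\in C_b(X,\mathbb R):\sup_{x\ne y}|f(x)-f(y)|/d_X(x,y)^\alpha<\infty\}$. The Ruelle operator is $\mathscr L_f\varphi(x)=\int_Ee^{f(ax)}\varphi(ax)\,dp(a)$, $ax=(a,x_1,x_2,\dots)$; its dual is given by $\int\varphi\,d[\mathscr L_f^*\mu]=\int\mathscr L_f\varphi\,d\mu$. $\mathscr M_{\mathrm{fin}}(X)$ is the set of finite non-negative (countably additive) Borel measures on $X$, and $\mathscr M_1(X)$ the set of Borel probability measures. A Markov operator is a map $P:\mathscr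 M_{\mathrm{fin}}(X)\to\mathscr M_{\mathrm{fin}}(X)$ that is positively linear ($P(\lambda_1\mu_1+\lambda_2\mu_2)=\lambda_1P\mu_1+\lambda_2P\mu_2$ for $\lambda_1,\lambda_2\ge0$) and satisfies $P\mu(X)=\mu(X)$. A measure $\mu$ is stationary if $P\mu=\mu$. $P$ is asymptotically stable if there is a stationary probability measure $\nu$ with $\lim_{n\to\infty}d(P^n\mu,\nu)=0$ for all $\mu\in\mathscr M_1(X)$. Wasserstein metric: let $f_n=\sum_{k=0}^{n-1}f\circ\sigma^k$ ($\sigma$ the left shift) and let $C_f>0$ be a constant with $|1-e^{f_n(ay)-f_n(ax)}|\le C_f\,d_X(x,y)^\alpha$ for all $x,y\in X$, $n\in\mathbb N$, $a\in E^n$ (where $ax$ denotes concatenation; such a constant exists). Put $\overline d(x,y)=\min\{1,4C_f\,d_X(x,y)^\alpha\}$ and $$d(\mu,\nu)=\sup\left\{\int g\,d(\mu-\nu):\ g:X\to\mathbb R,\ \sup_{x\ne y}\frac{|g(x)-g(y)|}{\overline d(x,y)}\le1\right\}.$$ *)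

(* Defs.v *)
From HB Require Import structures.
From mathcomp Require Import all_boot all_order all_algebra.
From mathcomp Require Import all_classical all_reals all_analysis.
From mathcomp Require Import lra.

Set Implicit Arguments.
Unset Strict Implicit.
Unset Printing Implicit Defensive.

Import Order.TTheory GRing.Theory Num.Theory.
Import numFieldNormedType.Exports.

Local Open Scope classical_set_scope.
Local Open Scope ring_scope.

(* [Complete] includes a distinguished point, which MathComp-Analysis requires
   of every measurable type. *)
#[short(type="completeMetricType")]
HB.structure Definition CompleteMetric (R : realType) :=
  {T of Metric R T & Complete T}.

Definition separable (T : topologicalType) :=
  exists D : set T, countable D /\ dense D.

Notation borel T := (g_sigma_algebraType (@open T)).

Notation finite_borel_measure R T :=
  {finite_measure set (borel T) -> \bar R}.

Definition sequence_space (R : realType) (E : completeMetricType R) : Type :=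
  nat -> E.

Section sequence_space.
Context {R : realType} {E : completeMetricType R}.
Implicit Types x y z : sequence_space E.

(* The coordinates x_1, x_2, ... of the text are x 0, x 1, ... here. *)
Let dterm x y : R^nat := fun n => 2^-1 ^+ n.+1 * Num.min (mdist (x n) (y n)) 1.

Definition seq_dist x y : R := limn (series (dterm x y)).

Let dterm_ge0 x y n : 0 <= dterm x y n.
Proof. by rewrite mulr_ge0 ?exprn_ge0// le_min mdist_ge0 ler01. Qed.

Let is_cvg_seq_dist x y : cvgn (series (dterm x y)).
Proof.
have half1 : `|2^-1 : R| < 1 by rewrite ger0_norm// invf_lt1// ltr1n.
apply: (@series_le_cvg _ _ (geometric 2^-1 2^-1)) => //.
- by move=> n; rewrite /geometric/= mulr_ge0// exprn_ge0.
- move=> n; rewrite /geometric/= -exprS /dterm ler_piMr ?exprn_ge0//.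
  by rewrite ge_min lexx orbT.
- exact: is_cvg_geometric_series.
Qed.

Let seq_distxx x : seq_dist x x = 0.
Proof.
rewrite /seq_dist (_ : series _ = fun=> 0); first exact: lim_cst.
apply/funext => n; rewrite /series/= big1// => i _.
by rewrite /dterm mdistxx min_l// mulr0.
Qed.

Let seq_dist_positivity x y : seq_dist x y = 0 -> x = y.
Proof.
move=> xy0; apply/funext => n; apply: mdist_positivity.
have ndec : nondecreasing_seq (series (dterm x y)).
  exact: nondecreasing_series (fun n _ _ => dterm_ge0 x y n).
have := nondecreasing_cvgn_le ndec (@is_cvg_seq_dist x y) n.+1.
rewrite -/(seq_dist x y) xy0 /series/= big_nat_recr//= => le0.
have : dterm x y n <= 0.
  by apply: le_trans le0; rewrite lerDr sumr_ge0.
rewrite /dterm pmulr_rle0 ?exprn_gt0// ge_min [1 <= 0]leNgt ltr01 orbF.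
by move=> d0; apply/eqP; rewrite eq_le d0 mdist_ge0.
Qed.

Let seq_dist_sym x y : seq_dist x y = seq_dist y x.
Proof.
congr (limn (series _)); apply/funext => n.
by rewrite /dterm metric_sym.
Qed.

Let seq_dist_triangle y x z : seq_dist x z <= seq_dist x y + seq_dist y z.
Proof.
rewrite -lim_seriesD//; apply: lim_series_le => //; first exact: is_cvg_seriesD.
move=> n; rewrite /dterm /= -[leRHS]mulrDr ler_wpM2l ?exprn_ge0//.
have := metric_triangle (x n) (y n) (z n).
have := mdist_ge0 (x n) (y n); have := mdist_ge0 (y n) (z n).
rewrite /Order.min; case: ifP => ?; case: ifP => ?; case: ifP => ?; lra.
Qed.

HB.instance Definition _ := Pointed.copy (sequence_space E) (nat -> E).
HB.instance Definition _ := @isMetric.Build R (sequence_space E)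
  seq_dist seq_distxx seq_dist_positivity seq_dist_sym seq_dist_triangle.

End sequence_space.

Section shift_space.
Context {R : realType} {E : completeMetricType R}.
Local Notation X := (sequence_space E).
Implicit Types (x y : X) (a : E).

Definition scons a x : X := fun n => if n is m.+1 then x m else a.

Definition sconcat (s : seq E) x : X := foldr scons x s.

Definition shift x : X := fun n => x n.+1.

Definition birkhoff_sum (f : X -> R) n x : R := \sum_(k < n) f (iter k shift x).

(* The supremum of |f x - f y| / D x y over x <> y, for D positive off the
   diagonal; it is -oo when there is no such pair. *)
Definition lip_const (D : X -> X -> R) (f : X -> R) : \bar R :=
  ereal_sup [set (`|f z.1 - f z.2| / D z.1 z.2)%:E
            | z in [set z : X * X | z.1 <> z.2]].

Definition Cb : set (X -> R) := [set phi | continuous phi /\ bounded_fun phi].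

Definition Hol (alpha : R) : set (X -> R) :=
  [set f | Cb f /\ (lip_const (fun x y => (mdist x y `^ alpha)%R) f < +oo)%E].

Definition ruelle (p : probability (borel E) R) (f phi : X -> R) (x : X) : R :=
  \int[p]_a (expR (f (scons a x)) * phi (scons a x)).

Local Notation Mfin := (finite_borel_measure R X).

(* Measures are functions on all sets; only measurable sets are relevant. *)
Definition measure_eq (m1 m2 : Mfin) : Prop :=
  forall A, measurable A -> m1 A = m2 A.

(* Finite Borel measures are determined by the integrals of functions of Cb,
   hence this determines P up to measure_eq. *)
Definition is_ruelle_dual (p : probability (borel E) R) (f : X -> R)
    (P : Mfin -> Mfin) : Prop :=
  forall (mu : Mfin) (phi : X -> R), Cb phi ->
    (\int[P mu]_x (phi x)%:E = \int[mu]_x (ruelle p f phi x)%:E)%E.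

Definition markov_operator (P : Mfin -> Mfin) : Prop :=
  (forall (l1 l2 : {nonneg R}) (mu1 mu2 mu : Mfin),
    (forall A, measurable A ->
       mu A = (l1%:num%:E * mu1 A + l2%:num%:E * mu2 A)%E) ->
    forall A, measurable A ->
      P mu A = (l1%:num%:E * P mu1 A + l2%:num%:E * P mu2 A)%E) /\
  (forall mu : Mfin, P mu setT = mu setT).

Definition stationary (P : Mfin -> Mfin) (mu : Mfin) : Prop :=
  measure_eq (P mu) mu.

Definition bar_dist (alpha Cf : R) x y : R :=
  Num.min 1 (4 * Cf * mdist x y `^ alpha).

(* Test functions are automatically bounded and continuous, because
   bar_dist <= 1 and bar_dist is continuous and vanishes on the diagonal. *)
Definition wasserstein (alpha Cf : R) (mu nu : Mfin) : \bar R :=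
  ereal_sup [set (\int[mu]_x (g x)%:E - \int[nu]_x (g x)%:E)%E
            | g in [set g : X -> R |
                    (lip_const (bar_dist alpha Cf) g <= 1)%E]].

Definition asymptotically_stable (d : Mfin -> Mfin -> \bar R)
    (P : Mfin -> Mfin) : Prop :=
  exists nu : probability (borel X) R, stationary P nu /\
    forall mu : probability (borel X) R,
      d (iter n P mu) nu @[n --> \oo] --> 0%E.

Definition distortion_constant (alpha : R) (f : X -> R) (Cf : R) : Prop :=
  0 < Cf /\
  forall x y n (a : n.-tuple E),
    `|1 - expR (birkhoff_sum f n (sconcat a y) - birkhoff_sum f n (sconcat a x))|
    <= Cf * mdist x y `^ alpha.

End shift_space.

(* Main.v *)
Require Import Defs.
From HB Require Import structures.
From mathcomp Require Import all_boot all_order all_algebra.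
From mathcomp Require Import all_classical all_reals all_analysis.
From mathcomp Require Import measurable_realfun.
From mathcomp Require Import ring lra.

Set Implicit Arguments.
Unset Strict Implicit.
Unset Printing Implicit Defensive.

Import Order.TTheory GRing.Theory Num.Theory.
Import numFieldNormedType.Exports.

Local Open Scope classical_set_scope.
Local Open Scope ring_scope.

(** Writing f_n(ax) for the Birkhoff sum over a word a of length n followed by x,
    the iterate L^n g(x) is the integral of exp(f_n(ax)) g(ax) over the words a.
    Bounded distortion is a Harnack inequality: the weights of a word over two
    tails x and y differ by a relative error Cf * d(x,y)^alpha. Hence L^N contracts
    the Lipschitz constants for the truncated metric of the Wasserstein distance
    when N is large (ruelle_contraction). If x and y are close, the error of the
    weights is a quarter of their distance and the points ax and ay are much closer
    than x and y; if they are distant, the two distributions over words share a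
    fixed proportion of their mass. So L^n g tends to a constant, exponentially
    fast and uniformly over the test functions g (iter_ruelle_limit). As integrals
    against P^n mu are integrals of L^n g against mu, this gives the rate of
    convergence to any stationary probability measure (wasserstein_rate).

    The remaining point is the existence of a stationary measure on a space that is
    not compact. For a cylinder A, the iterates of its indicator still converge to
    a constant, because L^k 1_A is Lipschitz once k reaches the number of
    coordinates on which A depends. The limits define an additive function on the
    algebra of cylinders. It is continuous at the empty set by an argument in the
    style of Ionescu-Tulcea: the same limits exist after conditioning on finitely
    many first letters, they disintegrate along the next letter, and so along a
    decreasing sequence of cylinders whose masses stay away from 0 one can choose
    letter after letter while keeping the conditional masses away from 0; the
    resulting sequence lies in all the cylinders (persistent_bigcap). The
    Caratheodory extension is a probability measure on X, as cylinders generate the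
    Borel sets. It is stationary because L 1_A is a uniform limit of functions of
    finitely many coordinates (limit_stationary), and unique because a stationary
    measure must give A the limit of L^n 1_A (stationary_unique).

    The dual operator exists since L acts on bounded measurable functions
    (ruelle_dual_exists); this uses that prepending a letter is jointly measurable,
    where separability of E enters (measurable_scons). Any other dual agrees with
    it on Borel sets because bounded continuous functions determine finite measures
    (Cb_measure_eq). *)

(** * The metric of the sequence space *)

Section sequence_metric.
Context {R : realType} {E : completeMetricType R}.
Local Notation X := (sequence_space E).
Implicit Types (x y : X) (a b : E).

Let dterm x y : R^nat := fun n => 2^-1 ^+ n.+1 * Num.min (mdist (x n) (y n)) 1.

Lemma seq_distE x y : mdist x y = limn (series (dterm x y)).
Proof. by []. Qed.

Let dterm_ge0 x y n : 0 <= dterm x y n.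
Proof. by rewrite mulr_ge0 ?exprn_ge0// le_min mdist_ge0 ler01. Qed.

Let dterm_le x y n : dterm x y n <= geometric 2^-1 2^-1 n.
Proof.
by rewrite /geometric/= -exprS ler_piMr ?exprn_ge0// ge_min lexx orbT.
Qed.

Let half1 : `|2^-1 : R| < 1.
Proof. by rewrite ger0_norm// invf_lt1// ltr1n. Qed.

Lemma is_cvg_seq_dist x y : cvgn (series (dterm x y)).
Proof.
apply: (@series_le_cvg _ _ (geometric 2^-1 2^-1)) => //.
- by move=> n; rewrite /geometric/= mulr_ge0// exprn_ge0.
- exact: is_cvg_geometric_series.
Qed.

Lemma seq_dist_le1 x y : mdist x y <= 1.
Proof.
have -> : (1 : R) = limn (series (geometric (2^-1 : R) 2^-1)).
  apply/esym/cvg_lim => //.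
  have := @cvg_geometric_series R 2^-1 _ half1.
  by rewrite [X in 2^-1 / X](_ : _ = 2^-1) ?divff//; lra.
rewrite seq_distE; apply: lim_series_le; [exact: is_cvg_seq_dist| |exact: dterm_le].
exact: is_cvg_geometric_series.
Qed.

Lemma seq_dist_head_tail x y : mdist x y =
  2^-1 * Num.min (mdist (x 0%N) (y 0%N)) 1 + 2^-1 * mdist (Defs.shift x) (Defs.shift y).
Proof.
rewrite !seq_distE; apply: cvg_lim => //.
rewrite -(cvg_shiftS (series (dterm x y)))/=.
rewrite [X in X @ _ --> _](_ : _ = (fun n => 2^-1 * Num.min (mdist (x 0%N) (y 0%N)) 1
  + 2^-1 * series (dterm (Defs.shift x) (Defs.shift y)) n)); last first.
  apply/funext => n; rewrite /series/= big_nat_recl// /dterm expr1 big_distrr/=.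
  by congr (_ + _); apply: eq_bigr => i _; rewrite mulrA -exprS.
apply: cvgD; first exact: cvg_cst.
by apply: cvgM; [exact: cvg_cst|exact: is_cvg_seq_dist].
Qed.

Lemma seq_dist_scons a b x y :
  mdist (scons a x) (scons b y) = 2^-1 * Num.min (mdist a b) 1 + 2^-1 * mdist x y.
Proof. by rewrite seq_dist_head_tail. Qed.

Lemma seq_dist_sconcat (s : seq E) x y :
  mdist (sconcat s x) (sconcat s y) = 2^-1 ^+ size s * mdist x y.
Proof.
elim: s => [|a s IH]/=; first by rewrite expr0 mul1r.
by rewrite seq_dist_scons IH mdistxx min_l ?ler01// mulr0 add0r mulrA -exprS.
Qed.

(** The metric controls each coordinate up to a factor; together with
    seq_dist_prefix this identifies its topology with the product topology. *)
Lemma seq_dist_coord n x y :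
  Num.min (mdist (x n) (y n)) 1 <= 2 ^+ n.+1 * mdist x y.
Proof.
elim: n x y => [|n IH] x y; rewrite seq_dist_head_tail.
  by rewrite expr1 mulrDr !mulrA divff// !mul1r lerDl mdist_ge0.
apply: le_trans (IH (Defs.shift x) (Defs.shift y)) _.
rewrite [leRHS](_ : _ = 2 ^+ n.+1 * Num.min (mdist (x 0%N) (y 0%N)) 1 +
  2 ^+ n.+1 * mdist (Defs.shift x) (Defs.shift y)); last by rewrite (exprS 2 n.+1); field.
by rewrite lerDr mulr_ge0 ?exprn_ge0// le_min mdist_ge0 ler01.
Qed.

Lemma seq_dist_prefix k (e : R) x y : 0 <= e ->
  (forall i, (i < k)%N -> mdist (x i) (y i) <= e) -> mdist x y <= e + 2^-1 ^+ k.
Proof.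
move=> e0; elim: k x y => [|k IH] x y xy.
  by rewrite expr0 (le_trans (seq_dist_le1 x y))// lerDr.
rewrite seq_dist_head_tail exprS.
have := IH (Defs.shift x) (Defs.shift y) (fun i ik => xy i.+1 ik).
have : Num.min (mdist (x 0%N) (y 0%N)) 1 <= e by rewrite ge_min xy.
lra.
Qed.

Lemma seq_dist_agree k x y : (forall i, (i < k)%N -> x i = y i) ->
  mdist x y <= 2^-1 ^+ k.
Proof.
move=> xy; rewrite -[leRHS]add0r; apply: seq_dist_prefix => // i ik.
by rewrite xy// mdistxx.
Qed.

End sequence_metric.

(** * Measurability of prepending a letter *)

Section borel_measurability.

Lemma metric_openP (K : realType) (T : metricType K) (W : set T) :
  open W <->
  (forall x, W x -> exists2 e : K, 0 < e & forall y, mdist x y < e -> W y).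
Proof.
split=> [oW x Wx|WP].
  have /nbhs_ballP[e e0 eW] := open_nbhs_nbhs (conj oW Wx).
  by exists e => // y xy; apply: eW; rewrite ballEmdist.
rewrite openE => x /WP[e e0 eW]; apply/nbhs_ballP; exists e => // y.
by rewrite ballEmdist; exact: eW.
Qed.

Lemma open_mdist_lt (K : realType) (T : metricType K) (x : T) (e : K) :
  open [set y | mdist x y < e].
Proof.
apply/metric_openP => y xy; exists (e - mdist x y); first by rewrite subr_gt0.
move=> z yz; rewrite /=; apply: le_lt_trans (metric_triangle x y z) _; lra.
Qed.

Lemma open_borel (T : ptopologicalType) (A : set T) :
  open A -> measurable (A : set (borel T)).
Proof. by move=> oA; exact: sub_sigma_algebra. Qed.

Lemma continuous_borel_fun (K : realType) (T : ptopologicalType) (g : T -> K) :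
  continuous g -> measurable_fun [set: borel T] g.
Proof.
move=> /continuousP cg; apply: (measurability _ (RGenOInfty.measurableE K)).
move=> _ [_ [a ->] <-]; rewrite setTI; apply: open_borel; apply: cg.
exact: interval_open.
Qed.

Context {R : realType} {E : completeMetricType R}.
Local Notation X := (sequence_space E).
Implicit Types (x y : X) (a b : E).

(** The preimage of an open set is open in E x X. It is a countable union of
    rectangles as soon as one factor is second countable: over each of countably
    many balls of E, take the largest open set of tails that goes with it. *)
Lemma measurable_scons : separable E ->
  measurable_fun setT (fun z : borel E * borel X => scons z.1 z.2 : borel X).
Proof.
move=> [D [cD dD]].
apply: (@measurability _ _ _ (borel X) _ _ (@open X)) => //.
move=> _ [W /metric_openP oW <-]; rewrite setTI.
pose V (c : E) (n : nat) := [set x : X | exists2 e : R, 0 < e &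
  forall b y, mdist c b < n.+1%:R^-1 -> mdist x y < e -> W (scons b y)].
have oV c n : open (V c n).
  apply/metric_openP => x [e e0 eW]; exists (e / 2); first by rewrite divr_gt0.
  move=> y xy; exists (e / 2); first by rewrite divr_gt0.
  move=> b z cb yz; apply: eW => //.
  by apply: le_lt_trans (metric_triangle x y z) _; lra.
rewrite (_ : _ @^-1` W = \bigcup_(c in D) \bigcup_n
    ([set b : borel E | mdist c b < n.+1%:R^-1] `*` (V c n : set (borel X)))).
  have /pfcard_geP[->|[s]] := cD; first by rewrite bigcup_set0.
  have -> : D = [set s n | n in setT] by rewrite image_eq.
  rewrite bigcup_image; apply: bigcupT_measurable => k.
  apply: bigcupT_measurable => n.
  by apply: measurableX; apply: open_borel => //; exact: open_mdist_lt.
apply/seteqP; split=> [[a x]/= Wax|[a x]/= [c Dc [n _ [/= ca [e e0 eW]]]]]; last first.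
  by apply: eW => //; rewrite mdistxx.
have [e e0 eW] := oW _ Wax.
have [n n1] : exists n, n.+1%:R^-1 < e / 2 :> R.
  have e2 : 0 < e / 2 by rewrite divr_gt0.
  exists (Num.truncn (e / 2)^-1); rewrite invf_plt ?posrE//.
  exact: truncnS_gt.
have n0 : 0 < n.+1%:R^-1 :> R by rewrite invr_gt0.
have [c [Dc ac]] : exists c, D c /\ mdist a c < n.+1%:R^-1.
  have [] := dD (ball a n.+1%:R^-1).
  - by exists a; exact: ballxx.
  - by rewrite ballEmdist; exact: open_mdist_lt.
  - by move=> c []; rewrite ballEmdist/= => ? ?; exists c.
exists c => //; exists n => //; split => /=; first by rewrite metric_sym.
exists e => // b y cb xy; apply: eW; rewrite seq_dist_scons.
have ab : mdist a b < e.
  apply: le_lt_trans (metric_triangle a c b) _.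
  by rewrite [ltRHS]splitr ltrD//; [exact: lt_trans ac n1|exact: lt_trans cb n1].
have : Num.min (mdist a b) 1 < e by rewrite gt_min ab.
lra.
Qed.

End borel_measurability.

(** * Integrals of bounded measurable functions *)

Section bounded_measurable.
Context d (T : measurableType d) (R : realType).
Implicit Types (g h : T -> R) (m : {finite_measure set T -> \bar R}).

Definition bmeas g := measurable_fun setT g /\ exists M : R, forall x, `|g x| <= M.

Lemma bmeas_cst (r : R) : bmeas (fun=> r).
Proof. by split; [exact: measurable_cst|exists `|r|]. Qed.

Lemma bmeasD g h : bmeas g -> bmeas h -> bmeas (fun x => g x + h x).
Proof.
move=> [mg [M gM]] [mh [N hN]]; split; first exact: measurable_funD.
by exists (M + N) => x; apply: le_trans (ler_normD _ _) _; exact: lerD.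
Qed.

Lemma bmeasM g h : bmeas g -> bmeas h -> bmeas (fun x => g x * h x).
Proof.
move=> [mg [M gM]] [mh [N hN]]; split; first exact: measurable_funM.
by exists (M * N) => x; rewrite normrM ler_pM.
Qed.

Lemma bmeasZ (r : R) g : bmeas g -> bmeas (fun x => r * g x).
Proof. by move=> bg; apply: bmeasM => //; exact: bmeas_cst. Qed.

Lemma bmeasN g : bmeas g -> bmeas (fun x => - g x).
Proof.
move=> /(bmeasZ (-1)); congr bmeas; apply/funext => x; exact: mulN1r.
Qed.

Lemma bmeasB g h : bmeas g -> bmeas h -> bmeas (fun x => g x - h x).
Proof. by move=> bg /bmeasN; exact: bmeasD. Qed.

Lemma bmeas_indic (A : set T) : measurable A -> bmeas \1_A.
Proof.
move=> mA; split; first exact: measurable_indic.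
by exists 1 => x; rewrite indicE; case: (_ \in _); rewrite ?normr1 ?normr0.
Qed.

Lemma bmeas_sum n (u : nat -> T -> R) : (forall i, bmeas (u i)) ->
  bmeas (fun x => \sum_(i < n) u i x).
Proof.
move=> bu; elim: n => [|n IH].
  by under eq_fun do rewrite big_ord0; exact: bmeas_cst.
by under eq_fun do rewrite big_ord_recr/=; exact: bmeasD.
Qed.

Lemma bmeas_integrable m g : bmeas g -> m.-integrable setT (EFin \o g).
Proof.
move=> [mg [M gM]]; apply: measurable_bounded_integrable => //.
  by rewrite -ge0_fin_numE// fin_num_measure.
by exists M; split; [exact: num_real|move=> N MN x _ /=; exact: le_trans (ltW MN)].
Qed.

Lemma EFin_Rintegral m g : bmeas g ->
  (\int[m]_x g x)%:E = (\int[m]_x (g x)%:E)%E.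
Proof.
by move=> /(bmeas_integrable m) ig; rewrite fineK//; exact: integrable_fin_num.
Qed.

Lemma RintD m g h : bmeas g -> bmeas h ->
  \int[m]_x (g x + h x) = \int[m]_x g x + \int[m]_x h x.
Proof. by move=> bg bh; rewrite RintegralD//; exact: bmeas_integrable. Qed.

Lemma RintZ m (r : R) g : bmeas g -> \int[m]_x (r * g x) = r * \int[m]_x g x.
Proof. by move=> bg; rewrite RintegralZl//; exact: bmeas_integrable. Qed.

Lemma RintB m g h : bmeas g -> bmeas h ->
  \int[m]_x (g x - h x) = \int[m]_x g x - \int[m]_x h x.
Proof. by move=> bg bh; rewrite RintegralB//; exact: bmeas_integrable. Qed.

Lemma Rint_sum m n (u : nat -> T -> R) : (forall i, bmeas (u i)) ->
  \int[m]_x (\sum_(i < n) u i x) = \sum_(i < n) \int[m]_x u i x.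
Proof.
move=> bu; elim: n => [|n IH].
  rewrite big_ord0; under eq_Rintegral do rewrite big_ord0.
  by rewrite Rintegral_cst// mul0r.
rewrite big_ord_recr/= -IH -RintD//; last exact: bmeas_sum.
by apply: eq_Rintegral => x _; rewrite big_ord_recr.
Qed.

Lemma Rint_le m g h : bmeas g -> bmeas h -> (forall x, g x <= h x) ->
  \int[m]_x g x <= \int[m]_x h x.
Proof. by move=> bg bh gh; apply: le_Rintegral => //; exact: bmeas_integrable. Qed.

Lemma Rint_indic m (A : set T) : measurable A ->
  (\int[m]_x \1_A x)%:E = m A.
Proof.
by move=> mA; rewrite EFin_Rintegral ?integral_indic ?setIT//; exact: bmeas_indic.
Qed.

Lemma Rint_dirac g (a : T) : bmeas g -> \int[dirac a]_x g x = g a.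
Proof.
move=> [mg _]; rewrite /Rintegral integral_dirac//; last exact/measurable_EFinP.
by rewrite diracT mul1e.
Qed.

Lemma Rint_bounded_cvg m (u : nat -> T -> R) g (M : R) :
  (forall n, measurable_fun setT (u n)) -> (forall n x, `|u n x| <= M) ->
  (forall x, u ^~ x @ \oo --> g x) ->
  bmeas g /\ \int[m]_x u n x @[n --> \oo] --> \int[m]_x g x.
Proof.
move=> mu uM ug.
have bg : bmeas g.
  split; first exact: (measurable_fun_cvg mu (fun x _ => ug x)).
  exists M => x; have /cvg_norm ugx := ug x.
  rewrite -(cvg_lim _ ugx)//; apply: limr_le; first by apply/cvg_ex; eexists; exact: ugx.
  exact: nearW.
split=> //; apply/fine_cvg; rewrite -/(Rintegral m setT g) EFin_Rintegral//.
apply: (@dominated_cvg _ _ _ m setT _ (fun n x => (u n x)%:E) _ (cst M%:E)) => //.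
- by move=> n; exact/measurable_EFinP.
- by move=> x _; apply: cvg_EFin; [exact: nearW|exact: ug].
- exact: (bmeas_integrable m (bmeas_cst M)).
- by move=> n x _; rewrite lee_fin.
Qed.

(** A layer-cake sum of indicators of superlevel sets. It is linear in the
    indicators, so identities between integrals pass from sets to functions. *)
Definition quantize (q : nat) g x : R :=
  \sum_(i < q) q%:R^-1 * \1_[set y | i.+1%:R * q%:R^-1 <= g y] x.

(** For values in [0, 1], quantize rounds down to a multiple of 1/q. *)
Lemma quantize_dist q g : (0 < q)%N -> (forall x, 0 <= g x <= 1) ->
  forall x, `|g x - quantize q g x| <= q%:R^-1.
Proof.
move=> q0 g01 x; have /andP[g0 g1] := g01 x.
have qR : 0 < q%:R :> R by rewrite ltr0n.
pose t := Num.truncn (q%:R * g x).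
have /andP[tlo thi] : t%:R <= q%:R * g x < t.+1%:R.
  by apply: truncn_itv; rewrite mulr_ge0// ltW.
have tq : (t <= q)%N by rewrite -(ler_nat R) (le_trans tlo)// ler_piMr// ltW.
have -> : quantize q g x = q%:R^-1 * t%:R.
  rewrite /quantize -big_distrr/=; congr (_ * _).
  transitivity (\sum_(i < q) ((i < t)%N%:R : R)).
    apply: eq_bigr => i _; rewrite indicE; congr ((nat_of_bool _)%:R).
    rewrite truncn_gt_nat [q%:R * _]mulrC -ler_pdivrMr//.
    by apply/idP/idP => [/set_mem//|?]; exact/mem_set.
  rewrite -(big_mkord xpredT (fun i => (i < t)%N%:R)) (big_cat_nat (n := t))//=.
  rewrite (eq_big_nat _ _ (F2 := fun=> 1)); last by move=> i /andP[_ ->].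
  rewrite big_const_nat subn0 iter_addr_0 big_nat big1 ?addr0//.
  by move=> i /andP[ti _]; rewrite ltnNge ti.
rewrite -(@ler_pM2l _ q%:R)// divff ?gt_eqF// -{1}(gtr0_norm qR) -normrM mulrBr mulrA.
rewrite divff ?gt_eqF// mul1r ler_norml; move: thi; rewrite -natr1.
by move=> thi; apply/andP; split; lra.
Qed.

Lemma measurable_superlevel g (t : R) : measurable_fun setT g ->
  measurable [set y | t <= g y].
Proof.
move=> mg; rewrite (_ : mkset _ = g @^-1` `[t, +oo[%classic).
  by rewrite -[X in measurable X]setTI; exact: mg.
by apply/seteqP; split => y /=; rewrite in_itv/= andbT.
Qed.

Lemma bmeas_quantize q g : measurable_fun setT g -> bmeas (quantize q g).
Proof.
move=> mg.
apply: (@bmeas_sum q (fun i x => q%:R^-1 * \1_[set y | i.+1%:R * q%:R^-1 <= g y] x)) => i.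
exact/bmeasZ/bmeas_indic/measurable_superlevel.
Qed.

End bounded_measurable.

(** * Fubini for bounded functions *)

Section bounded_fubini.
Context d1 d2 (T1 : measurableType d1) (T2 : measurableType d2) (R : realType).
Variables (m1 : {finite_measure set T1 -> \bar R})
          (m2 : {finite_measure set T2 -> \bar R}).
Variables (g : T1 * T2 -> R) (bg : bmeas g).

Let ig : (m1 \x m2)%E.-integrable setT (EFin \o g).
Proof.
have [mg [M gM]] := bg; apply: measurable_bounded_integrable => //.
  apply: (@le_lt_trans _ _ ((m1 \x m2)%E (setT `*` setT))); first by rewrite setXTT.
  rewrite product_measure1E// lte_mul_pinfty//.
  - exact: fin_num_measure.
  - by rewrite -ge0_fin_numE// fin_num_measure.
by exists M; split; [exact: num_real|move=> N MN x _ /=; exact: le_trans (ltW MN)].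
Qed.

Let bg1 x : bmeas (fun y => g (x, y)).
Proof.
have [mg [M gM]] := bg; split; first exact: measurableT_comp.
by exists M => y; exact: gM.
Qed.

Let bg2 y : bmeas (fun x => g (x, y)).
Proof.
have [mg [M gM]] := bg; split; first exact: measurableT_comp.
by exists M => x; exact: gM.
Qed.

Lemma bmeas_Rintegral1 : bmeas (fun y => \int[m1]_x g (x, y)).
Proof.
split.
  apply/measurable_EFinP; have := measurable_fubini_G ig.
  by congr measurable_fun; apply/funext => y; rewrite /fubini_G/= EFin_Rintegral.
have [_ [M gM]] := bg; exists (M * fine (m1 setT)) => y.
rewrite -Rintegral_cst//; apply: (le_trans (le_normr_Rintegral _ _)) => //.
  exact: bmeas_integrable.
apply: Rint_le => //; last exact: bmeas_cst.
by have [? ?] := bg2 y; split; [exact: measurableT_comp|exists M => x; rewrite normr_id].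
Qed.

Lemma bmeas_Rintegral2 : bmeas (fun x => \int[m2]_y g (x, y)).
Proof.
split.
  apply/measurable_EFinP; have := measurable_fubini_F ig.
  by congr measurable_fun; apply/funext => y; rewrite /fubini_F/= EFin_Rintegral.
have [_ [M gM]] := bg; exists (M * fine (m2 setT)) => x.
rewrite -Rintegral_cst//; apply: (le_trans (le_normr_Rintegral _ _)) => //.
  exact: bmeas_integrable.
apply: Rint_le => //; last exact: bmeas_cst.
by have [? ?] := bg1 x; split; [exact: measurableT_comp|exists M => y; rewrite normr_id].
Qed.

Lemma Rfubini : \int[m1]_x \int[m2]_y g (x, y) = \int[m2]_y \int[m1]_x g (x, y).
Proof.
apply: EFin_inj; rewrite (EFin_Rintegral _ bmeas_Rintegral2).
rewrite (EFin_Rintegral _ bmeas_Rintegral1).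
under eq_integral do rewrite EFin_Rintegral//.
under [RHS]eq_integral do rewrite EFin_Rintegral//.
exact: Fubini ig.
Qed.

End bounded_fubini.

(** * Measures from functionals on bounded measurable functions *)

Section measure_of_functional.
Context d (T : measurableType d) (R : realType).
Variable Lam : (T -> R) -> R.
Hypothesis LamD : forall g h, bmeas g -> bmeas h ->
  Lam (fun x => g x + h x) = Lam g + Lam h.
Hypothesis LamZ : forall (r : R) g, bmeas g -> Lam (fun x => r * g x) = r * Lam g.
Hypothesis Lam_ge0 : forall g, bmeas g -> (forall x, 0 <= g x) -> 0 <= Lam g.
Hypothesis Lam_cvg : forall (u : nat -> T -> R) g (M : R),
  (forall n, measurable_fun setT (u n)) -> (forall n x, `|u n x| <= M) ->
  (forall x, u ^~ x @ \oo --> g x) -> Lam (u n) @[n --> \oo] --> Lam g.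

Let Lam0 : Lam (fun=> 0) = 0.
Proof.
rewrite -[RHS](mul0r (Lam (fun=> 0))) -LamZ; last exact: bmeas_cst.
by congr Lam; apply/funext => x; rewrite mul0r.
Qed.

Let Lam_sum n (u : nat -> T -> R) : (forall i, bmeas (u i)) ->
  Lam (fun x => \sum_(i < n) u i x) = \sum_(i < n) Lam (u i).
Proof.
move=> bu; elim: n => [|n IH].
  rewrite big_ord0 -[RHS]Lam0.
  by congr Lam; apply/funext => x; rewrite big_ord0.
rewrite big_ord_recr/= -IH -LamD//; last exact: bmeas_sum.
by congr Lam; apply/funext => x; rewrite big_ord_recr.
Qed.

(* The value 0 outside the sigma-algebra only makes mu nonnegative everywhere. *)
Let mu (A : set T) : \bar R := if A \in measurable then (Lam \1_A)%:E else 0%E.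

Let muE A : measurable A -> mu A = (Lam \1_A)%:E.
Proof. by move=> mA; rewrite /mu mem_set. Qed.

Let mu0 : mu set0 = 0%E.
Proof. by rewrite muE// indic0 Lam0. Qed.

Let mu_ge0 A : (0 <= mu A)%E.
Proof.
rewrite /mu; case: ifPn => // /set_mem mA; rewrite lee_fin.
by apply: Lam_ge0 => //; exact: bmeas_indic.
Qed.

Let mu_sigma_additive : semi_sigma_additive mu.
Proof.
move=> F mF tF mUF; rewrite muE//.
rewrite [X in X @ _ --> _](_ : _ =
    EFin \o (fun n => Lam (fun x => \sum_(i < n) \1_(F i) x))); last first.
  apply/funext => n; rewrite /= (@Lam_sum n (fun i => \1_(F i))); last first.
    by move=> i; exact: bmeas_indic.
  by rewrite big_mkord -sumEFin; apply: eq_bigr => i _; rewrite muE.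
apply: cvg_EFin; first exact: nearW.
have sE n x : (\sum_(i < n) \1_(F i) x)%:E =
    (\sum_(0 <= k < n) (\1_(F k) x)%:E)%E :> \bar R.
  by rewrite big_mkord sumEFin.
have F0 x k : (0 <= (\1_(F k) x)%:E :> \bar R)%E by rewrite lee_fin.
apply: (@Lam_cvg _ _ 1).
- move=> n; suff [] : bmeas (fun x : T => \sum_(i < n) \1_(F i) x : R) by [].
  by apply: (@bmeas_sum _ _ R n (fun i => \1_(F i))) => i; exact: bmeas_indic.
- move=> n x; rewrite ger0_norm ?sumr_ge0// -lee_fin sE.
  apply: le_trans (nneseries_lim_ge _ _) _ => //.
  by rewrite -indic_bigcup// lee_fin indicE lern1 leq_b1.
- move=> x; rewrite [X in X @ _ --> _](_ : _ =
      fine \o (fun n => (\sum_(0 <= k < n) (\1_(F k) x)%:E)%E)); last first.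
    by apply/funext => n; rewrite /= -sE.
  by apply: fine_cvg; rewrite indic_bigcup//; exact: is_cvg_nneseries.
Qed.

Definition functional_measure := mu.

HB.instance Definition _ := isMeasure.Build _ _ _ functional_measure
  mu0 mu_ge0 mu_sigma_additive.

Let fin_mu : fin_num_fun functional_measure.
Proof. by move=> A mA; rewrite /functional_measure muE. Qed.

HB.instance Definition _ := Measure_isFinite.Build _ _ _ functional_measure fin_mu.

Let Lam_quantize q g : measurable_fun setT g ->
  \int[functional_measure]_x quantize q g x = Lam (quantize q g).
Proof.
move=> mg; pose A i := [set y | i.+1%:R * q%:R^-1 <= g y].
have mA i : measurable (A i) by exact: measurable_superlevel.
have bA i : bmeas (fun x => q%:R^-1 * \1_(A i) x) by apply/bmeasZ/bmeas_indic.
rewrite (@Rint_sum _ _ _ _ q (fun i x => q%:R^-1 * \1_(A i) x))//.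
rewrite (@Lam_sum q (fun i x => q%:R^-1 * \1_(A i) x))//; apply: eq_bigr => i _.
rewrite RintZ ?LamZ; [|exact: bmeas_indic..]; congr (_ * _).
by apply: EFin_inj; rewrite Rint_indic// -muE.
Qed.

Let int01 g : bmeas g -> (forall x, 0 <= g x <= 1) ->
  \int[functional_measure]_x g x = Lam g.
Proof.
move=> [mg bg] g01.
have qg x : quantize n.+1 g x @[n --> \oo] --> g x.
  apply/cvgrPdist_le => e e0; near=> n.
  apply: (le_trans (quantize_dist (ltn0Sn n) g01 x)); apply: ltW.
  by near: n; exact: near_infty_natSinv_lt (PosNum e0).
have qM n x : `|quantize n.+1 g x| <= 2.
  have n1 : n.+1%:R^-1 <= 1 :> R by rewrite invf_le1// ler1n.
  have := le_trans (quantize_dist (ltn0Sn n) g01 x) n1; have := g01 x.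
  by rewrite !ler_norml => /andP[? ?] /andP[? ?]; apply/andP; split; lra.
have mq n : measurable_fun setT (quantize n.+1 g) by exact: (bmeas_quantize _ mg).1.
have [_ qI] := Rint_bounded_cvg functional_measure mq qM qg.
have := Lam_cvg mq qM qg.
under eq_fun do rewrite -Lam_quantize//.
by move=> /(cvg_unique _ qI) ->.
Unshelve. all: end_near. Qed.

(** Since Lam is continuous along bounded pointwise limits, its values on
    indicators are countably additive, and uniform approximation by step
    functions identifies Lam with the integral. *)
Lemma measure_of_functional : exists m : {finite_measure set T -> \bar R},
  forall g, bmeas g -> \int[m]_x g x = Lam g.
Proof.
exists functional_measure => g bg; have [mg [M gM]] := bg.
pose N := `|M| + 1; have N0 : 0 < N by rewrite ltr_wpDl.
have gN x : `|g x| <= N by apply: le_trans (gM x) _; rewrite (le_trans (ler_norm M))// lerDl.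
pose h x := (2 * N)^-1 * (g x + N).
have bh : bmeas h by apply/bmeasZ/bmeasD => //; exact: bmeas_cst.
have gE : g = fun x => 2 * N * h x + (- N) * 1.
  by apply/funext => x; rewrite /h mulrA divff ?gt_eqF ?mulr_gt0//; lra.
have b1 : bmeas (fun x : T => 1 : R) by exact: bmeas_cst.
rewrite gE LamD; [|exact: bmeasZ..]; rewrite RintD; [|exact: bmeasZ..].
rewrite (RintZ _ (2 * N) bh) (RintZ _ (- N) b1) (LamZ (2 * N) bh) (LamZ (- N) b1) !int01//.
  by move=> x; rewrite lexx ler01.
move=> x; rewrite /h; have := gN x; rewrite ler_norml => /andP[gl gu].
rewrite mulr_ge0 ?invr_ge0 ?mulr_ge0 ?(ltW N0)//=; last by lra.
by rewrite mulrC ler_pdivrMr ?mulr_gt0// mul1r; lra.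
Qed.

End measure_of_functional.

(** * The transfer operator and its dual *)

Section transfer_operator.
Context {R : realType} {E : completeMetricType R}.
Local Notation X := (sequence_space E).
Local Notation BX := (borel X).
Local Notation BE := (borel E).
Implicit Types (x y : X) (a b : E) (phi psi g : BX -> R).
Implicit Types (mu : finite_borel_measure R X).
Variables (p : probability BE R) (f : X -> R).
Hypotheses (sepE : separable E) (bf : @bmeas _ BX R f).
Hypothesis L1 : forall x, ruelle p f (fun=> 1) x = 1.

Local Notation L := (ruelle p f : (X -> R) -> X -> R).

(** Averaging over b gives the transfer operator. With b fixed, this is the
    unnormalized conditioning of phi on the first letter b. *)
Definition branch b (phi : X -> R) x := expR (f (scons b x)) * phi (scons b x).

Lemma bmeas_branch2 phi : bmeas phi ->
  bmeas (fun z : BE * BX => branch z.1 phi z.2).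
Proof.
move=> [mphi [M phiM]]; have [mf [N fN]] := bf.
have msc := measurable_scons sepE.
apply: bmeasM; split.
- apply: measurableT_comp; first exact: measurable_expR.
  exact: (measurableT_comp mf msc).
- exists (expR N) => z; rewrite ger0_norm ?expR_ge0// ler_expR.
  exact: le_trans (ler_norm _) (fN _).
- exact: (measurableT_comp mphi msc).
- by exists M => z; exact: phiM.
Qed.

Lemma bmeas_branch b phi : bmeas phi -> @bmeas _ BX R (branch b phi).
Proof.
move=> /bmeas_branch2[m2 [M bM]]; split; last by exists M => x; exact: (bM (b, x)).
rewrite (_ : branch b phi = (fun z : BE * BX => branch z.1 phi z.2) \o pair b)//.
exact: (measurableT_comp m2 (pair1_measurable (b : BE))).
Qed.

Lemma bmeas_branch1 x phi : bmeas phi -> @bmeas _ BE R (fun b => branch b phi x).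
Proof.
move=> /bmeas_branch2[m2 [M bM]]; split; last by exists M => b; exact: (bM (b, x)).
rewrite (_ : (fun _ => _) = (fun z : BE * BX => branch z.1 phi z.2) \o pair^~ x)//.
exact: (measurableT_comp m2 (pair2_measurable (x : BX))).
Qed.

Lemma ruelleE phi x : L phi x = \int[p]_b branch b phi x.
Proof. by []. Qed.

Lemma bmeas_ruelle phi : bmeas phi -> @bmeas _ BX R (L phi).
Proof.
(* The Dirac mass only serves to put the parameter x into a product space. *)
move=> /bmeas_branch2; exact: (@bmeas_Rintegral1 _ _ BE BX R p (dirac (point : BX))).
Qed.

Lemma bmeas_iter_ruelle n phi : bmeas phi -> @bmeas _ BX R (iter n L phi).
Proof. by move=> bphi; elim: n => //= n; exact: bmeas_ruelle. Qed.

Lemma ruelleD phi psi x : bmeas phi -> bmeas psi ->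
  L (fun y => phi y + psi y) x = L phi x + L psi x.
Proof.
move=> bphi bpsi; rewrite !ruelleE -RintD; [|exact: bmeas_branch1..].
by apply: eq_Rintegral => b _; rewrite /branch mulrDr.
Qed.

Lemma ruelleZ (r : R) phi x : bmeas phi -> L (fun y => r * phi y) x = r * L phi x.
Proof.
move=> bphi; rewrite !ruelleE -RintZ; last exact: bmeas_branch1.
by apply: eq_Rintegral => b _; rewrite /branch mulrCA.
Qed.

Lemma ruelle_cst (r : R) x : L (fun=> r) x = r.
Proof.
rewrite -[RHS]mulr1 -(L1 x) -ruelleZ; last exact: bmeas_cst.
by congr (ruelle p f _ x); apply/funext => y; rewrite mulr1.
Qed.

Lemma ruelle_le phi psi x : bmeas phi -> bmeas psi ->
  (forall y, phi y <= psi y) -> L phi x <= L psi x.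
Proof.
move=> bphi bpsi le; apply: Rint_le; [exact: bmeas_branch1..|].
by move=> b; rewrite /branch ler_pM2l ?expR_gt0.
Qed.

Lemma ruelle_itv phi (m M : R) x : bmeas phi -> (forall y, m <= phi y <= M) ->
  m <= L phi x <= M.
Proof.
move=> bphi phimM; rewrite -{1}(ruelle_cst m x) -{1}(ruelle_cst M x).
apply/andP; split; apply: ruelle_le; rewrite //; try exact: bmeas_cst.
  by move=> y; case/andP: (phimM y).
by move=> y; case/andP: (phimM y).
Qed.

Lemma iter_ruelle_itv n phi (m M : R) x : bmeas phi -> (forall y, m <= phi y <= M) ->
  m <= iter n L phi x <= M.
Proof.
move=> bphi phimM; elim: n x => //= n IH x; apply: ruelle_itv => //.
exact: bmeas_iter_ruelle.
Qed.

Lemma ruelle_cvg (u : nat -> BX -> R) phi (M : R) x :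
  (forall n, measurable_fun setT (u n)) -> (forall n y, `|u n y| <= M) ->
  (forall y, u ^~ y @ \oo --> phi y) -> L (u n) x @[n --> \oo] --> L phi x.
Proof.
move=> mu uM uphi.
have bu n : bmeas (u n) by split => //; exists M.
have [_ [N bN]] := bmeas_branch2 (bmeas_cst BX (1 : R)).
apply: (Rint_bounded_cvg p (M := N * M) (u := fun n b => branch b (u n) x)
  (g := fun b => branch b phi x) _ _ _).2.
- by move=> n; have [] := bmeas_branch1 x (bu n).
- move=> n b; rewrite normrM ler_pM//.
  by have := bN (b, x); rewrite /branch/= mulr1.
- by move=> b; apply: cvgM; [exact: cvg_cst|exact: uphi].
Qed.

(** The functional phi |-> \int L phi dmu is positive, linear and continuous along
    bounded pointwise limits, hence is the integral for some measure. *)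
Lemma ruelle_dual_exists : exists P : finite_borel_measure R X -> finite_borel_measure R X,
  forall mu phi, bmeas phi -> \int[P mu]_x phi x = \int[mu]_x L phi x.
Proof.
have {}dual mu : exists m : finite_borel_measure R X,
    forall phi, bmeas phi -> \int[m]_x phi x = \int[mu]_x L phi x.
  apply: measure_of_functional.
  - move=> g h bg bh; under eq_Rintegral do rewrite ruelleD//.
    by rewrite RintD//; exact: bmeas_ruelle.
  - move=> r g bg; under eq_Rintegral do rewrite ruelleZ//.
    by rewrite RintZ//; exact: bmeas_ruelle.
  - move=> g bg g0; apply: Rintegral_ge0 => x _; rewrite -(ruelle_cst 0 x).
    by apply: ruelle_le => //; exact: bmeas_cst.
  - move=> u g M mu' uM ug.
    have bu n : bmeas (u n) by split => //; exists M.
    apply: (Rint_bounded_cvg mu (M := M) (u := fun n => L (u n)) _ _ _).2.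
    + by move=> n; have [] := bmeas_ruelle (bu n).
    + move=> n x; rewrite ler_norml; apply: ruelle_itv => // y.
      by rewrite -ler_norml.
    + by move=> x; exact: ruelle_cvg.
by have [P PE] := choice dual; exists P.
Qed.

Lemma dual_iter (P : finite_borel_measure R X -> finite_borel_measure R X) n mu phi :
  (forall mu phi, bmeas phi -> \int[P mu]_x phi x = \int[mu]_x L phi x) ->
  bmeas phi -> \int[iter n P mu]_x phi x = \int[mu]_x iter n L phi x.
Proof.
move=> dual; elim: n phi => [//|n IH] phi bphi.
by rewrite [iter n.+1 P _]iterS dual// IH ?iterSr//; exact: bmeas_ruelle.
Qed.

Lemma iter_shift_sconcat (s : seq E) x :
  iter (size s) (@Defs.shift R E) (sconcat s x) = x.
Proof. by elim: s x => //= a s IH x; rewrite -iterS iterSr; exact: IH. Qed.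

Lemma birkhoff_sum_rcons n (s : n.-tuple E) b x :
  birkhoff_sum f n.+1 (sconcat (rcons s b) x) =
  birkhoff_sum f n (sconcat s (scons b x)) + f (scons b x).
Proof.
rewrite /birkhoff_sum big_ord_recr/= /sconcat foldr_rcons -/(sconcat _ _).
by have := iter_shift_sconcat s (scons b x); rewrite size_tuple => ->.
Qed.

(** The n-th iterate integrates exp(f_n(ax)) phi(ax) over the words a of length n,
    so a comparison of these weights word by word is inherited by the iterates.
    The scalars u and v absorb the weight of the last letter in the induction. *)
Lemma iter_ruelle_le n phi psi (u v : R) x y : bmeas phi -> bmeas psi ->
  (forall s : n.-tuple E,
    u * (expR (birkhoff_sum f n (sconcat s x)) * phi (sconcat s x)) <=
    v * (expR (birkhoff_sum f n (sconcat s y)) * psi (sconcat s y))) ->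
  u * iter n L phi x <= v * iter n L psi y.
Proof.
move=> bphi bpsi; elim: n u v x y => [|n IH] u v x y le.
  by have := le [tuple]; rewrite /birkhoff_sum !big_ord0 expR0 !mul1r.
rewrite !iterS !ruelleE -!RintZ; [|by apply/bmeas_branch1/bmeas_iter_ruelle..].
apply: Rint_le; [by apply/bmeasZ/bmeas_branch1/bmeas_iter_ruelle..|].
move=> b; rewrite /branch !mulrA; apply: IH => s.
have := le [tuple of rcons s b]; rewrite !birkhoff_sum_rcons !expRD /sconcat !foldr_rcons.
rewrite -!/(sconcat _ _); congr (_ <= _); ring.
Qed.

End transfer_operator.

(** * Contraction of oscillations *)

Section contraction.
Context {R : realType} {E : completeMetricType R}.
Local Notation X := (sequence_space E).
Local Notation BX := (borel X).
Local Notation BE := (borel E).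
Implicit Types (x y : X) (a b : E) (phi psi g : BX -> R).
Implicit Types (mu : finite_borel_measure R X).
Variables (p : probability BE R) (f : X -> R) (alpha Cf : R).
Hypotheses (sepE : separable E) (bf : @bmeas _ BX R f).
Hypothesis L1 : forall x, ruelle p f (fun=> 1) x = 1.
Hypotheses (alpha0 : 0 < alpha) (distortion : distortion_constant alpha f Cf).

Local Notation L := (ruelle p f : (X -> R) -> X -> R).
Local Notation D := (bar_dist alpha Cf).

Let Cf0 : 0 < Cf. Proof. by have [] := distortion. Qed.

Lemma hol_dist_le1 x y : mdist x y `^ alpha <= 1.
Proof.
have p1 : 1 `^ alpha = 1 :> R by rewrite powR1.
rewrite -[leRHS]p1; apply: ge0_ler_powR; rewrite ?nnegrE ?ler01//.
- exact: ltW.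
- exact: mdist_ge0.
- exact: seq_dist_le1.
Qed.

Lemma bar_dist_le1 x y : D x y <= 1.
Proof. by rewrite ge_min lexx. Qed.

Lemma bar_dist_sym x y : D x y = D y x.
Proof. by rewrite /bar_dist metric_sym. Qed.

(** Lipschitz for the metric of the Wasserstein distance. The one-sided form is
    equivalent to the two-sided one because that metric is symmetric. *)
Definition bar_lip (c : R) (g : X -> R) := forall x y, g x <= g y + c * D x y.

Lemma bar_lip_itv c g : 0 <= c -> bmeas g -> bar_lip c g ->
  exists m, forall x, m <= g x <= m + c.
Proof.
move=> c0 [_ [M gM]] lg; have g_inf : has_inf (range g).
  split; first by exists (g point), point.
  by exists (- M) => _ [x _ <-]; have := gM x; rewrite ler_norml => /andP[].
exists (inf (range g)) => x; apply/andP; split.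
  by apply: ge_inf; [exact: g_inf.2|exists x].
rewrite -lerBlDr; apply: lb_le_inf; first exact: g_inf.1.
move=> _ [y _ <-]; rewrite lerBlDr (le_trans (lg x y))// lerD2l ler_piMr//.
exact: bar_dist_le1.
Qed.

(** Bounded distortion read as a Harnack inequality between the weights of the
    same word over two tails. *)
Lemma word_weight_le n (s : n.-tuple E) x y :
  expR (birkhoff_sum f n (sconcat s x)) <=
  (1 + Cf * mdist x y `^ alpha) * expR (birkhoff_sum f n (sconcat s y)).
Proof.
have [_ /(_ y x n s)] := distortion; rewrite (metric_sym y) distrC.
rewrite ler_norml => /andP[_].
rewrite lerBlDl -(ler_pM2r (expR_gt0 (birkhoff_sum f n (sconcat s y)))).
by rewrite -expRD subrK.
Qed.

Lemma iter_ruelleDc n phi (r : R) x : bmeas phi ->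
  iter n L (fun y => phi y + r) x = iter n L phi x + r.
Proof.
move=> bphi; elim: n x => //= n IH x.
transitivity (L (fun y => iter n L phi y + r) x).
  by congr (ruelle p f _ x); apply/funext => y; exact: IH.
by rewrite ruelleD//; [rewrite ruelle_cst|exact: bmeas_iter_ruelle|exact: bmeas_cst].
Qed.

(* Prepending a word of length n multiplies the Hoelder distance by pow2 n. *)
Let pow2 (n : nat) := (2^-1 ^+ n) `^ alpha : R.

Lemma bar_dist_sconcat n (s : n.-tuple E) x y :
  D (sconcat s x) (sconcat s y) <= 4 * Cf * (pow2 n * mdist x y `^ alpha).
Proof.
rewrite ge_min seq_dist_sconcat size_tuple powRM ?lexx ?orbT ?exprn_ge0//.
exact: mdist_ge0.
Qed.

(** For close tails: the values of g along a common word differ by at most the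
    factor pow2 n of the distance, and the weights by the relative error
    Cf * d^alpha, which is a quarter of the distance. *)
Lemma iter_ruelle_near n c g x y : 0 <= c -> bmeas g -> (forall z, 0 <= g z <= c) ->
  bar_lip c g ->
  iter n L g x <= iter n L g y + c * ((4^-1 + pow2 n) * (4 * Cf * mdist x y `^ alpha)).
Proof.
move=> c0 bg g0c lg; set delta := mdist x y `^ alpha.
have d0 : 0 <= delta by exact: powR_ge0.
set t := c * _; rewrite -iter_ruelleDc// -[leLHS]mul1r -[leRHS]mul1r.
apply: iter_ruelle_le => //; first by apply: bmeasD => //; exact: bmeas_cst.
move=> s; rewrite !mul1r.
set w := expR (birkhoff_sum f n (sconcat s y)).
have w0 : 0 <= w by exact: expR_ge0.
have /andP[gs0 gsc] := g0c (sconcat s x).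
have gxy : g (sconcat s x) <= g (sconcat s y) + c * (4 * Cf * (pow2 n * delta)).
  by apply: le_trans (lg _ (sconcat s y)) _; rewrite lerD2l ler_wpM2l// bar_dist_sconcat.
apply: (@le_trans _ _ ((1 + Cf * delta) * w * g (sconcat s x))).
  by rewrite ler_wpM2r// word_weight_le.
rewrite [leLHS](_ : _ = w * (g (sconcat s x) + Cf * delta * g (sconcat s x))); last by ring.
rewrite ler_wpM2l//.
have : Cf * delta * g (sconcat s x) <= Cf * delta * c by rewrite ler_wpM2l// mulr_ge0// ltW.
have -> : t = Cf * delta * c + c * (4 * Cf * (pow2 n * delta)) by rewrite /t; field.
lra.
Qed.

(** For distant tails: by the Harnack inequality the two word distributions share
    a proportion 1 / (1 + Cf) of their mass, and on the shared part the values of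
    g nearly agree. *)
Lemma iter_ruelle_far n c g x y : 0 <= c -> bmeas g -> (forall z, 0 <= g z <= c) ->
  bar_lip c g ->
  iter n L g x <= iter n L g y + c * (1 - (1 + Cf)^-1 + pow2 n * (4 * Cf)).
Proof.
move=> c0 bg g0c lg; set delta := mdist x y `^ alpha.
have [d0 d1] : 0 <= delta /\ delta <= 1 by rewrite powR_ge0 hol_dist_le1.
have q0 : 0 <= pow2 n by exact: powR_ge0.
have C1 : 0 < 1 + Cf by rewrite addr_gt0.
set t := c * (4 * Cf * (pow2 n * delta)).
have key : (1 + Cf)^-1 * iter n L g x <= 1 * iter n L (fun z => g z + t) y.
  apply: iter_ruelle_le => //; first by apply: bmeasD => //; exact: bmeas_cst.
  move=> s; rewrite mul1r.
  set w := expR (birkhoff_sum f n (sconcat s y)).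
  have w0 : 0 <= w by exact: expR_ge0.
  have /andP[gs0 gsc] := g0c (sconcat s x).
  have gxy : g (sconcat s x) <= g (sconcat s y) + t.
    by apply: le_trans (lg _ (sconcat s y)) _; rewrite lerD2l ler_wpM2l// bar_dist_sconcat.
  apply: le_trans (ler_wpM2l w0 gxy); rewrite mulrA ler_wpM2r//.
  rewrite mulrC ler_pdivrMr// mulrC; apply: le_trans (word_weight_le s x y) _.
  by rewrite ler_wpM2r// lerD2l ler_piMr// ltW.
rewrite mul1r iter_ruelleDc// in key.
have /andP[_ Lc] : 0 <= iter n L g x <= c by exact: iter_ruelle_itv.
have tle : t <= c * (pow2 n * (4 * Cf)).
  rewrite (_ : t = c * (pow2 n * (4 * Cf) * delta)); last by rewrite /t; ring.
  by rewrite ler_wpM2l// ler_piMr// !mulr_ge0// ltW.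
have : (1 - (1 + Cf)^-1) * iter n L g x <= (1 - (1 + Cf)^-1) * c.
  by rewrite ler_wpM2l// subr_ge0 invf_le1// lerDl ltW.
lra.
Qed.

Lemma pow2_cvg0 : pow2 n @[n --> \oo] --> 0.
Proof.
have -> : pow2 = (fun n => (2^-1 `^ alpha) ^+ n).
  by apply/funext => n; rewrite /pow2 -!powR_mulrn ?powR_ge0// -!powRrM mulrC.
apply: cvg_expr; rewrite ger0_norm ?powR_ge0//.
have p1 : 1 `^ alpha = 1 :> R by rewrite powR1.
rewrite -[ltRHS]p1; apply: gt0_ltr_powR; rewrite ?nnegrE//.
by rewrite invf_lt1// ltr1n.
Qed.

(** The truncation at 1 in the metric separates the two regimes. Below 1, N is
    chosen so that the two errors add up to at most half of the distance; at 1, the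
    common mass of the word distributions outweighs the difference of the values. *)
Lemma ruelle_contraction : exists N (s : R), [/\ (0 < N)%N, 0 < s < 1 &
  forall (c : R) g, 0 <= c -> bmeas g -> bar_lip c g -> bar_lip (s * c) (iter N L g)].
Proof.
have C1 : 0 < 1 + Cf by rewrite addr_gt0.
pose kappa := (1 + Cf)^-1; have k0 : 0 < kappa by rewrite invr_gt0.
have k1 : kappa <= 1 by rewrite invf_le1// lerDl ltW.
have [N N0 [qN1 qN2]] : exists2 N, (0 < N)%N & pow2 N <= 4^-1 /\ pow2 N * (4 * Cf) <= kappa / 2.
  near \oo => N; exists N; first by near: N; exact: nbhs_infty_gt.
  split; first by near: N; apply: (cvgr_le _ pow2_cvg0); rewrite invr_gt0.
  rewrite -ler_pdivlMr ?mulr_gt0//; near: N; apply: (cvgr_le _ pow2_cvg0).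
  by rewrite !divr_gt0 ?mulr_gt0.
exists N, (1 - kappa / 2); split=> //; first by apply/andP; split; lra.
move=> c g c0 bg lg x y.
have [m gm] := bar_lip_itv c0 bg lg.
(* L fixes constants, so g may be shifted to take its values in [0, c]. *)
pose h z := g z + - m.
have bh : bmeas h by apply: bmeasD => //; exact: bmeas_cst.
have h0c z : 0 <= h z <= c by have := gm z; rewrite /h => /andP[? ?]; apply/andP; split; lra.
have lh : bar_lip c h by move=> z z'; have := lg z z'; rewrite /h; lra.
suff : iter N L h x <= iter N L h y + (1 - kappa / 2) * c * D x y.
  by rewrite /h !iter_ruelleDc//; lra.
have [far|near] := lerP 1 (4 * Cf * mdist x y `^ alpha).
  rewrite /bar_dist min_l// mulr1.
  apply: le_trans (iter_ruelle_far N x y c0 bh h0c lh) _; rewrite lerD2l mulrC ler_wpM2r//.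
  rewrite -/kappa; lra.
rewrite /bar_dist min_r; last exact: ltW.
apply: le_trans (iter_ruelle_near N x y c0 bh h0c lh) _; rewrite lerD2l mulrA.
rewrite ler_wpM2r//; first by rewrite !mulr_ge0 ?powR_ge0// ltW.
rewrite mulrC ler_wpM2r//; lra.
Unshelve. all: end_near. Qed.

(** Contraction every N steps, at the rate s^(1/N) per step; the constant s^-1 pays
    for the incomplete last block, on which L does not increase oscillations. *)
Lemma ruelle_oscillation : exists C s : R, [/\ 0 < C, 0 < s < 1 &
  forall (c : R) g, 0 <= c -> bmeas g -> bar_lip c g -> forall n,
  exists m, forall x, m <= iter n L g x <= m + c * (C * s ^+ n)].
Proof.
have [N [s [N0 /andP[s0 s1] contr]]] := ruelle_contraction.
pose r := s `^ N%:R^-1.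
have rN : r ^+ N = s.
  by rewrite -powR_mulrn ?powR_ge0// -powRrM mulVf ?powRr1// ?ltW// pnatr_eq0 -lt0n.
have r0 : 0 < r by rewrite powR_gt0.
have r1 : r < 1.
  rewrite ltNge; apply/negP => r1; have := exprn_ege1 N r1; rewrite rN; lra.
exists s^-1, r; split; rewrite ?invr_gt0 ?r0//.
move=> c g c0 bg lg n.
have lk k : bar_lip (s ^+ k * c) (iter (k * N) L g).
  elim: k => [|k IH]; first by rewrite mul0n expr0 mul1r.
  rewrite mulSn iterD exprS -mulrA; apply: contr => //.
    by rewrite mulr_ge0// exprn_ge0// ltW.
  exact: bmeas_iter_ruelle.
have bk : @bmeas _ BX R (iter (n %/ N * N)%N L g) by exact: bmeas_iter_ruelle.
have sk0 : 0 <= s ^+ (n %/ N) * c by rewrite mulr_ge0// exprn_ge0// ltW.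
have [m gm] := bar_lip_itv sk0 bk (lk (n %/ N)%N).
exists m => x; rewrite [in iter n _ _](divn_eq n N) addnC iterD.
have /andP[-> /=] := iter_ruelle_itv sepE bf L1 (n %% N)%N x bk gm.
move/le_trans; apply; rewrite lerD2l mulrC ler_wpM2l//.
rewrite ler_pdivlMl// -{1}rN -{1}rN -exprM -exprD.
apply: ler_wiXn2l; rewrite ?ltW// [leqLHS](divn_eq n N) addnC mulnC leq_add2r ltnW//.
by rewrite ltn_mod.
Qed.

End contraction.

(** * The limiting functional and its conditional versions *)

Section limit_functional.
Context {R : realType} {E : completeMetricType R}.
Local Notation X := (sequence_space E).
Local Notation BX := (borel X).
Local Notation BE := (borel E).
Implicit Types (x y : X) (a b : E) (phi psi g : BX -> R) (u : nat -> BX -> R).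
Implicit Types (mu : finite_borel_measure R X).

Definition cylinder k : set (set X) := [set A | measurable (A : set BX) /\
  forall x y, (forall i, (i < k)%N -> x i = y i) -> A x -> A y].

Lemma sconcat_nth (s : seq E) x a i : (i < size s)%N -> sconcat s x i = nth a s i.
Proof. by elim: s i => // b s IH [|i]//= /IH. Qed.

Variables (p : probability BE R) (f : X -> R) (alpha Cf : R).
Hypotheses (sepE : separable E) (bf : @bmeas _ BX R f).
Hypothesis L1 : forall x, ruelle p f (fun=> 1) x = 1.
Hypotheses (alpha0 : 0 < alpha) (distortion : distortion_constant alpha f Cf).

Local Notation L := (ruelle p f : (X -> R) -> X -> R).

(** All later iterates stay between the bounds of the n-th one, so the geometric
    decay of the oscillation forces convergence to a constant. *)
Lemma iter_ruelle_limit : exists C s : R, [/\ 0 < C, 0 < s < 1 &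
  forall (c : R) g, 0 <= c -> bmeas g -> bar_lip alpha Cf c g ->
  exists l, forall n x, `|iter n L g x - l| <= c * (C * s ^+ n)].
Proof.
have [C [s [C0 s01 osc]]] := ruelle_oscillation sepE bf L1 alpha0 distortion.
have /andP[s0 s1] := s01.
exists C, s; split=> // c g c0 bg lg.
have {}osc := osc c g c0 bg lg.
have near0 (e : R) : 0 < e -> \forall n \near \oo, c * (C * s ^+ n) < e.
  move=> e0; have : (c * C) * s ^+ n @[n --> \oo] --> c * C * 0.
    by apply: cvgM; [exact: cvg_cst|apply: cvg_expr; rewrite ger0_norm// ltW].
  rewrite mulr0 => /cvgr_lt/(_ e e0); apply: filterS => n; by rewrite mulrA.
have cl : cvgn (fun n => iter n L g point).
  apply: cauchy_cvg; apply: cauchy_exP => e e0.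
  have [n _ /(_ n (leqnn n)) ne] := near0 e e0.
  have [m gm] := osc n; exists (iter n L g point); exists n => // k/= nk.
  rewrite -(subnK nk) iterD.
  have := iter_ruelle_itv sepE bf L1 (k - n) point (bmeas_iter_ruelle p sepE bf n bg) gm.
  have := gm point; rewrite /ball/= ltr_norml => /andP[? ?] /andP[? ?].
  by apply/andP; split; lra.
exists (limn (fun n => iter n L g point)) => n x.
have [m gm] := osc n.
have lm : m <= limn (fun n => iter n L g point) <= m + c * (C * s ^+ n).
  apply/andP; split.
    apply: limr_ge => //; exists n => // k/= nk; rewrite -(subnK nk) iterD.
    by have /andP[] := iter_ruelle_itv sepE bf L1 (k - n) point
         (bmeas_iter_ruelle p sepE bf n bg) gm.
  apply: limr_le => //; exists n => // k/= nk; rewrite -(subnK nk) iterD.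
  by have /andP[] := iter_ruelle_itv sepE bf L1 (k - n) point
       (bmeas_iter_ruelle p sepE bf n bg) gm.
have := gm x; move: lm => /andP[? ?] /andP[? ?].
by rewrite ler_norml; apply/andP; split; lra.
Qed.

(** The Harnack inequality for the weights exp(f_n) psi over all long words. It
    holds for indicators of cylinders, passes to the branches, and makes L^j psi
    Lipschitz: a class of possibly discontinuous functions whose iterates still
    converge. *)
Definition word_lip j (psi : X -> R) := forall n (s : n.-tuple E) x y, (j <= n)%N ->
  expR (birkhoff_sum f n (sconcat s x)) * psi (sconcat s x) <=
  (1 + Cf * mdist x y `^ alpha) *
    (expR (birkhoff_sum f n (sconcat s y)) * psi (sconcat s y)).

Lemma cylinder_word_lip k A : cylinder k A -> word_lip k \1_A.
Proof.
move=> [_ Ak] n s x y kn; rewrite mulrA.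
have -> : \1_A (sconcat s x) = \1_A (sconcat s y) :> R.
  have agree z z' i : (i < k)%N -> sconcat s z i = sconcat s z' i.
    by move=> ik; rewrite !(sconcat_nth _ point)// size_tuple (leq_trans ik).
  rewrite !indicE; congr ((nat_of_bool _)%:R).
  by apply/idP/idP => /set_mem/Ak h; apply/mem_set/h/agree.
by rewrite ler_wpM2r//; exact: word_weight_le.
Qed.

Lemma word_lip_branch b j psi : word_lip j psi -> word_lip j (branch f b psi).
Proof.
move=> lpsi n s x y jn.
have birk z : birkhoff_sum f n.+1 (sconcat (b :: s) z) =
    birkhoff_sum f n (sconcat s z) + f (scons b (sconcat s z)).
  rewrite /birkhoff_sum big_ord_recl addrC /=; congr (_ + _).
  by apply: eq_bigr => i _; rewrite -iterS iterSr.
have := lpsi n.+1 [tuple of b :: s] x y (leqW jn).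
by rewrite !birk !expRD /branch !mulrA.
Qed.

Lemma word_lip_iter j psi (M : R) : bmeas psi -> (forall x, 0 <= psi x <= M) ->
  word_lip j psi -> bar_lip alpha Cf M (iter j L psi).
Proof.
move=> bpsi psiM lpsi x y; have [Cf0 _] := distortion.
set delta := mdist x y `^ alpha; have d0 : 0 <= delta by exact: powR_ge0.
have : 1 * iter j L psi x <= (1 + Cf * delta) * iter j L psi y.
  apply: iter_ruelle_le => // s; rewrite mul1r; exact: lpsi.
have /andP[Lx0 LxM] := iter_ruelle_itv sepE bf L1 j x bpsi psiM.
have /andP[Ly0 LyM] := iter_ruelle_itv sepE bf L1 j y bpsi psiM.
have M0 : 0 <= M := le_trans Lx0 LxM.
rewrite mul1r => Lxy; rewrite /bar_dist -/delta.
have [far|near] := lerP 1 (4 * Cf * delta); first by rewrite mulr1; lra.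
apply: le_trans Lxy _; rewrite mulrDl mul1r lerD2l.
have Cd0 : 0 <= Cf * delta by rewrite mulr_ge0// ltW.
apply: (@le_trans _ _ (Cf * delta * M)); first by rewrite ler_wpM2l.
rewrite mulrC ler_wpM2l//; lra.
Qed.

(** For the functions considered here the iterates converge to the same limit at
    every point; the base point only serves to name it. *)
Definition ruelle_lim (psi : X -> R) := limn (fun n => iter n L psi point).

Lemma word_lip_cvg j psi (M : R) x : bmeas psi -> (forall x, 0 <= psi x <= M) ->
  word_lip j psi -> iter n L psi x @[n --> \oo] --> ruelle_lim psi.
Proof.
move=> bpsi psiM lpsi.
have M0 : 0 <= M by have /andP[/le_trans] := psiM point; apply.
have [C [s [C0 /andP[s0 s1] lim]]] := iter_ruelle_limit.
have [l nl] := lim _ _ M0 (bmeas_iter_ruelle p sepE bf j bpsi) (word_lip_iter bpsi psiM lpsi).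
have cl z : iter n L psi z @[n --> \oo] --> l.
  rewrite -(cvg_shiftn j); apply/cvgrPdist_le => e e0.
  have /cvgr_le/(_ e) : (M * C) * s ^+ n @[n --> \oo] --> M * C * 0.
    by apply: cvgM; [exact: cvg_cst|apply: cvg_expr; rewrite ger0_norm// ltW].
  rewrite mulr0 => /(_ e0); apply: filterS => n; apply: le_trans.
  by rewrite /= distrC -mulrA iterD; exact: nl.
by rewrite /ruelle_lim (cvg_lim _ (cl point)).
Qed.

Lemma ruelle_lim_ge0 psi : bmeas psi -> (forall x, 0 <= psi x) ->
  cvgn (fun n => iter n L psi point) -> 0 <= ruelle_lim psi.
Proof.
move=> bpsi psi0 cl; apply: limr_ge => //; apply: nearW => n.
have [_ [M psiM]] := bpsi.
have psi0M x : 0 <= psi x <= M by rewrite psi0 (le_trans (ler_norm _)).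
by have /andP[] := iter_ruelle_itv sepE bf L1 n point bpsi psi0M.
Qed.

(** The integral over the first letter can be pulled out of the iterates. Writing
    these as integrals for P^n of a Dirac mass, this is Fubini on E x X. *)
Lemma iter_ruelle_branch psi n x : bmeas psi ->
  @bmeas _ BE R (fun b => iter n L (branch f b psi) x) /\
  iter n.+1 L psi x = \int[p]_b iter n L (branch f b psi) x.
Proof.
move=> bpsi; have [P dual] := ruelle_dual_exists sepE bf L1.
pose m : finite_borel_measure R X := iter n P (dirac (x : BX)).
have mE phi : bmeas phi -> \int[m]_y phi y = iter n L phi x.
  move=> bphi; rewrite (dual_iter sepE bf n _ dual)// Rint_dirac//.
  exact: bmeas_iter_ruelle.
have b2 := bmeas_branch2 sepE bf bpsi.
split.
  have := @bmeas_Rintegral2 _ _ BE BX R p m _ b2.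
  congr bmeas; apply/funext => b /=; rewrite mE//; exact: bmeas_branch.
rewrite iterSr -mE; last exact: bmeas_ruelle.
rewrite -[LHS](@Rfubini _ _ BE BX R p m _ b2); apply: eq_Rintegral => b _ /=.
by rewrite mE//; exact: bmeas_branch.
Qed.

Lemma branch_bound psi (M : R) : bmeas psi -> (forall x, 0 <= psi x <= M) ->
  exists K, forall b x, 0 <= branch f b psi x <= K.
Proof.
move=> bpsi psiM; have [_ [K bK]] := bmeas_branch2 sepE bf bpsi.
exists K => b x; apply/andP; split.
  by rewrite mulr_ge0 ?expR_ge0//; case/andP: (psiM (scons b x)).
by apply: le_trans (ler_norm _) (bK (b, x)).
Qed.

(** Disintegration of the limiting functional along the first letter, obtained from
    the finite iterates by dominated convergence. *)
Lemma ruelle_lim_branch j psi (M : R) : bmeas psi -> (forall x, 0 <= psi x <= M) ->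
  word_lip j psi ->
  @bmeas _ BE R (fun b => ruelle_lim (branch f b psi)) /\
  ruelle_lim psi = \int[p]_b ruelle_lim (branch f b psi).
Proof.
move=> bpsi psiM lpsi.
have [K bK] := branch_bound bpsi psiM.
have cb b : iter n L (branch f b psi) point @[n --> \oo] --> ruelle_lim (branch f b psi).
  apply: (word_lip_cvg _ _ (bK b)); last exact: (word_lip_branch _ lpsi).
  exact: bmeas_branch.
have [|n b|] := Rint_bounded_cvg p (M := K)
   (u := fun n (b : BE) => iter n L (branch f b psi) point) _ _ cb.
- by move=> n; have [[]] := iter_ruelle_branch n point bpsi.
- have /andP[? ?] := iter_ruelle_itv sepE bf L1 n point
      (bmeas_branch sepE bf b bpsi) (bK b).
  by rewrite ger0_norm.
move=> bl; split=> //.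
apply: (@cvg_unique _ _ (iter n.+1 L psi point @[n --> \oo])) => //.
  have := word_lip_cvg point bpsi psiM lpsi.
  by rewrite -(cvg_shiftS (fun n => iter n L psi point)).
rewrite /=; under eq_fun do rewrite -iterS (iter_ruelle_branch _ _ bpsi).2.
by [].
Qed.

(** The situation to be carried along in the construction of a common point of a
    decreasing sequence of cylinders: their conditional masses, given the letters
    chosen so far, do not tend to 0. *)
Definition persistent u := exists M e : R, 0 < e /\ forall n,
  [/\ bmeas (u n), exists j, word_lip j (u n), forall x, 0 <= u n x <= M,
      forall x, u n.+1 x <= u n x & e <= ruelle_lim (u n)].

(** If the conditional masses tended to 0 for every choice b of the next letter,
    so would their integral over b, by dominated convergence. *)
Lemma persistent_branch u : persistent u ->
  exists b, persistent (fun n => branch f b (u n)).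
Proof.
move=> [M [e [e0 up]]].
have bu n : bmeas (u n) by have [] := up n.
have uM n x : 0 <= u n x <= M by have [] := up n.
have lu n : exists j, word_lip j (u n) by have [] := up n.
have [K MK] : exists K, forall b x, 0 <= branch f b (fun=> M) x <= K.
  apply: (@branch_bound _ M); first exact: bmeas_cst.
  by move=> x; rewrite lexx andbT; have /andP[/le_trans] := uM 0%N x; apply.
have uK n b x : 0 <= branch f b (u n) x <= K.
  have /andP[_ MKb] := MK b x; have /andP[u0 uM'] := uM n (scons b x).
  apply/andP; split; first by rewrite mulr_ge0 ?expR_ge0.
  by apply: le_trans MKb; rewrite ler_wpM2l ?expR_ge0.
have bub n b : @bmeas _ BX R (branch f b (u n)) by exact: bmeas_branch.
have lub n b : exists j, word_lip j (branch f b (u n)).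
  by have [j lj] := lu n; exists j; exact: word_lip_branch.
have cub n b : iter k L (branch f b (u n)) point @[k --> \oo] -->
    ruelle_lim (branch f b (u n)).
  by have [j lj] := lub n b; exact: (word_lip_cvg _ (bub n b) (uK n b) lj).
have ndec n b : ruelle_lim (branch f b (u n.+1)) <= ruelle_lim (branch f b (u n)).
  apply: ler_lim; [by apply/cvg_ex; eexists; exact: cub..|apply: nearW => k].
  rewrite -[leLHS]mul1r -[leRHS]mul1r; apply: iter_ruelle_le => // s.
  rewrite !mul1r ler_wpM2l ?expR_ge0// ler_wpM2l ?expR_ge0//.
  by have [] := up n.
have I0 n b : 0 <= ruelle_lim (branch f b (u n)) <= K.
  have key k : 0 <= iter k L (branch f b (u n)) point <= K by exact: iter_ruelle_itv.
  apply/andP; split.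
    by apply: limr_ge; [apply/cvg_ex; eexists; exact: cub|apply: nearW => k; case/andP: (key k)].
  by apply: limr_le; [apply/cvg_ex; eexists; exact: cub|apply: nearW => k; case/andP: (key k)].
suff [b [e' [e'0 be]]] : exists b e', 0 < e' /\ forall n, e' <= ruelle_lim (branch f b (u n)).
  exists b, K, e'; split=> // n; split=> //.
  by move=> x; rewrite ler_wpM2l ?expR_ge0//; have [] := up n.
apply: contrapT => nobranch.
have lim0 b : ruelle_lim (branch f b (u n)) @[n --> \oo] --> 0.
  apply/cvgrPdist_lt => e' e'0.
  have [N Ne] : exists N, ruelle_lim (branch f b (u N)) < e'.
    apply: contrapT => none; apply: nobranch; exists b, e'; split=> // n.
    by rewrite leNgt; apply/negP => ne; apply: none; exists n.
  exists N => // n/= Nn; rewrite sub0r normrN ger0_norm; last by case/andP: (I0 n b).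
  apply: le_lt_trans Ne; elim: n Nn => [|n IH]; first by rewrite leqn0 => /eqP ->.
  by rewrite leq_eqVlt => /predU1P[->//|/IH]; exact: le_trans.
have [|||_] := Rint_bounded_cvg p (M := K)
   (u := fun n (b : BE) => ruelle_lim (branch f b (u n))) (g := fun=> 0).
- by move=> n; have [j lj] := lu n; have [[]] := ruelle_lim_branch (bu n) (uM n) lj.
- by move=> n b; have /andP[? ?] := I0 n b; rewrite ger0_norm.
- exact: lim0.
rewrite Rintegral_cst// mul0r => /cvgr_lt/(_ e e0)[N _ /(_ N (leqnn N))].
rewrite /=; have [j lj] := lu N; have [_ <-] := ruelle_lim_branch (bu N) (uM N) lj.
by rewrite ltNge => /negP; apply; have [] := up N.
Qed.

(** Choosing letters one after the other as in the theorem of Ionescu-Tulcea gives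
    a sequence x whose prefixes all leave positive conditional mass to every A n.
    As A n depends on finitely many coordinates, a long enough prefix decides that
    x belongs to it. *)
Lemma persistent_bigcap (A : (set X)^nat) : (forall n, exists k, cylinder k (A n)) ->
  persistent (fun n => \1_(A n)) -> exists x, forall n, A n x.
Proof.
move=> cA pA.
pose next u := if pselect (persistent u) is left h
  then sval (cid (persistent_branch h)) else point.
pose step u n := branch f (next u) (u n).
have step_persistent u : persistent u -> persistent (step u).
  move=> h; rewrite /step /next; case: pselect => // h'.
  by case: cid.
(* v k n is the indicator of A n conditioned on the first k letters. *)
pose v k := iter k step (fun n => \1_(A n)).
have vp k : persistent (v k) by elim: k => //= k; exact: step_persistent.
pose x k := next (v k).
have vE k n y : exists w, v k n y = w * \1_(A n) (sconcat (mkseq x k) y).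
  elim: k y => [|k IH] y; first by exists 1; rewrite mul1r.
  have [w wE] := IH (scons (x k) y).
  exists (expR (f (scons (x k) y)) * w).
  rewrite /v iterS -/(v k) /step /branch -/(x k) wE mulrA.
  by rewrite mkseqS /sconcat foldr_rcons.
exists x => n; have [k [_ Ak]] := cA n.
have [y vy] : exists y, v k n y != 0.
  apply: contrapT => /forallNP v0.
  have [M [e [e0 /(_ n)[bv _ _ _]]]] := vp k.
  suff -> : ruelle_lim (v k n) = 0 by rewrite leNgt e0.
  have -> : v k n = (fun=> 0).
    by apply/funext => y; apply/eqP; apply/negPn/negP; exact: v0.
  apply: cvg_lim => //; rewrite (_ : (fun n => _) = fun=> 0); first exact: cvg_cst.
  apply/funext => i; apply/eqP; rewrite eq_le andbC.
  by apply: iter_ruelle_itv => // [|z]; [exact: bmeas_cst|rewrite lexx].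
have [w wE] := vE k n y.
apply: (Ak (sconcat (mkseq x k) y)).
  by move=> i ik; rewrite (sconcat_nth _ point) ?size_mkseq// nth_mkseq.
move: vy; rewrite wE indicE; have [/set_mem//|_] := boolP (_ \in A n).
by rewrite mulr0 eqxx.
Qed.

End limit_functional.

(** * Extension of a content from an algebra of sets *)

Section algebra_extension.
Context d (T : algebraOfSetsType d) (R : realType).
Variable m : set T -> R.
Hypothesis m_ge0 : forall A, measurable A -> 0 <= m A.
Hypothesis mU : forall A B, measurable A -> measurable B -> A `&` B = set0 ->
  m (A `|` B) = m A + m B.
(* Continuity at the empty set, in contrapositive form. *)
Hypothesis m_cap : forall (F : (set T)^nat) (e : R), (forall n, measurable (F n)) ->
  (forall n, F n.+1 `<=` F n) -> 0 < e -> (forall n, e <= m (F n)) ->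
  exists x, forall n, F n x.

Let mu (A : set T) : \bar R := if A \in measurable then (m A)%:E else 0%E.

Let muE A : measurable A -> mu A = (m A)%:E.
Proof. by move=> mA; rewrite /mu mem_set. Qed.

Let m0 : m set0 = 0.
Proof.
have := mU measurable0 measurable0 (setI0 set0); rewrite setU0; lra.
Qed.

Let mu0 : mu set0 = 0%E. Proof. by rewrite muE// m0. Qed.

Let mu_ge0 A : (0 <= mu A)%E.
Proof. by rewrite /mu; case: ifPn => // /set_mem mA; rewrite lee_fin m_ge0. Qed.

Let le_m A B : measurable A -> measurable B -> A `<=` B -> m A <= m B.
Proof.
move=> mA mB AB; have mBA := measurableD mB mA.
by rewrite -(setDUK AB) mU ?setDIK// lerDl m_ge0.
Qed.

Let mu_sigma_additive : semi_sigma_additive mu.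
Proof.
move=> F mF tF mUF; rewrite muE//; set U := \bigcup_n F n.
pose G n := U `\` \bigcup_(i < n) F i.
have mFn n : measurable (\bigcup_(i < n) F i).
  by rewrite bigcup_mkord; exact: bigsetU_measurable.
have mG n : measurable (G n) by exact: measurableD.
have GS n : G n.+1 `<=` G n.
  apply: setDS => x [i /= ni Fix]; exists i => //=; exact: ltnW.
have sumE n : m U = \sum_(i < n) m (F i) + m (G n).
  elim: n => [|n IH].
    by rewrite big_ord0 add0r /G bigcup_mkord big_ord0 setD0.
  rewrite IH big_ord_recr/= -addrA; congr (_ + _).
  rewrite -mU//; first congr m.
    apply/seteqP; split => [x [Ux nx]|x [Fx|[Ux nx]]].
    - have [Fx|Fx] := pselect (F n x); [by left|right; split => // -[i/=]].
      rewrite ltnS leq_eqVlt => /predU1P[->//|ni Fix]; apply: nx; by exists i.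
    - split; first by exists n.
      move=> [i/= ni Fix]; have := tF i n Logic.I Logic.I (ex_intro _ x (conj Fix Fx)).
      by move=> iE; rewrite iE ltnn in ni.
    - by split => // -[i/= ni Fix]; apply: nx; exists i => //=; exact: ltnW.
  apply/seteqP; split => // x [Fx [_]]; apply; exists n => //=.
have G0 : m (G n) @[n --> \oo] --> 0.
  apply/cvgrPdist_lt => e e0.
  have [N Ne] : exists N, m (G N) < e.
    apply: contrapT => none; have [|x xG] := m_cap mG GS e0.
      by move=> n; rewrite leNgt; apply/negP => ne; apply: none; exists n.
    have [[n _ Fx] _] := xG 0%N; have [_] := xG n.+1; apply.
    by exists n => /=.
  exists N => // n/= Nn; rewrite sub0r normrN ger0_norm ?m_ge0//.
  apply: le_lt_trans Ne; elim: n Nn => [|n IH]; first by rewrite leqn0 => /eqP ->.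
  rewrite leq_eqVlt => /predU1P[->//|/IH]; apply: le_trans; exact: le_m.
rewrite [X in X @ _ --> _](_ : _ = fun n => (m U - m (G n))%:E); last first.
  apply/funext => n; rewrite {1}(sumE n) addrK big_mkord -sumEFin.
  by apply: eq_bigr => i _; rewrite muE.
apply: cvg_EFin; first exact: nearW.
rewrite -[X in _ --> X]subr0; apply: cvgB => //; exact: cvg_cst.
Qed.

(** The remainders of a disjoint union decrease to the empty set, so m_cap makes
    m countably additive and the Caratheodory extension applies. *)
Lemma algebra_extension :
  exists nu : {measure set (g_sigma_algebraType (@measurable _ T)) -> \bar R},
    forall A : set T, measurable A -> nu A = (m A)%:E.
Proof.
pose M : {measure set T -> \bar R} :=
  HB.pack mu (isMeasure.Build _ _ _ mu mu0 mu_ge0 mu_sigma_additive).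
exists (measure_extension M) => A mA.
by rewrite /= /measure_extension measurable_mu_extE//= muE.
Qed.

End algebra_extension.

(** * Cylinder sets *)

Section cylinder_algebra.
Context {R : realType} {E : completeMetricType R}.
Local Notation X := (sequence_space E).
Local Notation BX := (borel X).

Definition cylinders : set (set X) := [set A | exists k, cylinder k A].

Lemma cylinderW k n (A : set X) : (k <= n)%N -> cylinder k A -> cylinder n A.
Proof.
move=> kn [mA Ak]; split=> // x y xy; apply: Ak => i ik.
by apply: xy; exact: leq_trans kn.
Qed.

Lemma cylindersT : cylinders setT.
Proof. by exists 0%N; split. Qed.

Lemma cylindersC A : cylinders A -> cylinders (~` A).
Proof.
move=> [k [mA Ak]]; exists k; split; first exact: measurableC.
by move=> x y xy nA Ay; apply: nA; apply: Ak Ay => i /xy.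
Qed.

Lemma cylindersI A B : cylinders A -> cylinders B -> cylinders (A `&` B).
Proof.
move=> [k Ak] [n Bn]; exists (maxn k n).
have [mA {}Ak] := cylinderW (leq_maxl k n) Ak.
have [mB {}Bn] := cylinderW (leq_maxr k n) Bn.
split; first exact: measurableI.
by move=> x y xy [Ax Bx]; split; [exact: Ak Ax|exact: Bn Bx].
Qed.

Lemma cylindersU A B : cylinders A -> cylinders B -> cylinders (A `|` B).
Proof.
move=> cA cB; rewrite -(setCK (_ `|` _)) setCU.
by apply: cylindersC; apply: cylindersI; exact: cylindersC.
Qed.

Lemma cylinders0 : cylinders set0.
Proof. by rewrite -setCT; exact: cylindersC cylindersT. Qed.

(** The k-th cylinder consists of the points that a control on the first k
    coordinates alone keeps inside W, uniformly near the point. The uniform margin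
    makes it open, hence Borel. *)
Lemma open_bigcup_cylinder (W : set X) : open W ->
  exists F : (set X)^nat, (forall k, cylinder k (F k)) /\ W = \bigcup_k F k.
Proof.
move=> /metric_openP oW.
pose F k := [set x : X | exists2 e : R, 0 < e &
  forall y, (forall i, (i < k)%N -> mdist (x i) (y i) < e) -> W y].
exists F; split=> [k|].
  split.
    apply: open_borel; apply/metric_openP => x [e e0 eW].
    pose r : R := Num.min (e / 2) 1.
    have r0 : 0 < r by rewrite lt_min divr_gt0//= ltr01.
    exists (r / 2 ^+ k); first by rewrite divr_gt0// exprn_gt0.
    move=> y xy; exists (e / 2); first by rewrite divr_gt0.
    move=> z yz; apply: eW => i ik.
    suff xyi : mdist (x i) (y i) < e / 2.
      by apply: le_lt_trans (metric_triangle _ (y i) _) _; have := yz i ik; lra.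
    have : Num.min (mdist (x i) (y i)) 1 < r.
      apply: le_lt_trans (seq_dist_coord i x y) _.
      rewrite ltr_pdivlMr ?exprn_gt0// in xy; apply: le_lt_trans xy.
      by rewrite mulrC ler_wpM2l ?mdist_ge0// ler_weXn2l// ler1n.
    rewrite /r lt_min => /andP[+ h]; move: h; rewrite gt_min ltxx orbF => h.
    by rewrite /Order.min h.
  move=> x y xy [e e0 eW]; exists e => // z yz; apply: eW => i ik.
  by rewrite xy//; exact: yz.
apply/seteqP; split=> [x /oW[e e0 eW]|x [k _ [e e0 eW]]]; last first.
  by apply: eW => i _; rewrite mdistxx.
have [k ke] : exists k, 2^-1 ^+ k < e / 2.
  have e2 : 0 < e / 2 by rewrite divr_gt0.
  have : (2^-1 : R) ^+ n @[n --> \oo] --> 0.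
    by apply: cvg_expr; rewrite ger0_norm// invf_lt1// ltr1n.
  by move=> /cvgr_lt/(_ _ e2)[k _ /(_ k (leqnn k))]; exists k.
exists k => //; exists (e / 2); first by rewrite divr_gt0.
move=> y xy; apply: eW.
apply: le_lt_trans (seq_dist_prefix (e := e / 2) (k := k) _ _) _.
- by rewrite divr_ge0// ltW.
- by move=> i ik; exact/ltW/xy.
- lra.
Qed.

Lemma borel_cylinders : @measurable _ BX = <<s cylinders >>.
Proof.
apply/seteqP; split.
  apply: smallest_sub; first exact: smallest_sigma_algebra.
  move=> W /open_bigcup_cylinder[F [cF ->]].
  apply: (@bigcupT_measurable _ (g_sigma_algebraType cylinders)) => k.
  by apply: sub_sigma_algebra; exists k.
apply: smallest_sub; first exact: sigma_algebra_measurable.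
by move=> A [k []].
Qed.

Lemma cylinders_measure_eq (m1 m2 : {finite_measure set BX -> \bar R}) :
  (forall A, cylinders A -> m1 A = m2 A) -> measure_eq m1 m2.
Proof.
move=> m12 A mA; apply: (@measure_unique _ R BX cylinders (fun=> setT) _ _ _ _ m1 m2) => //.
- exact: borel_cylinders.
- exact: cylindersI.
- by move=> _; exact: cylindersT.
- by rewrite bigcup_const.
- by move=> _; rewrite -ge0_fin_numE// fin_num_measure.
Qed.

(** A copy of X, so that the algebra of cylinders does not clash with the Borel
    sigma-algebra. *)
Definition cylinder_space : Type := X.
HB.instance Definition _ := Pointed.on cylinder_space.

Fact cylinder_display : measure_display. Proof. by []. Qed.

HB.instance Definition _ := isAlgebraOfSets.Build cylinder_display cylinder_space
  cylinders0 cylindersU cylindersC.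

End cylinder_algebra.

(** * The limit measure and its stationarity *)

Section stationary_measure.
Context {R : realType} {E : completeMetricType R}.
Local Notation X := (sequence_space E).
Local Notation BX := (borel X).
Local Notation BE := (borel E).
Implicit Types (x y : X) (a b : E) (phi psi g h : BX -> R).
Implicit Types (mu : finite_borel_measure R X).

Definition truncate k x : X := fun i => if (i < k)%N then x i else point.

Lemma truncate_agree k x i : (i < k)%N -> truncate k x i = x i.
Proof. by rewrite /truncate => ->. Qed.

Lemma seq_dist_truncate k x y : mdist (truncate k x) (truncate k y) <= mdist x y.
Proof.
elim: k x y => [|k IH] x y.
  by rewrite (_ : truncate 0 x = truncate 0 y)// mdistxx mdist_ge0.
rewrite [leLHS]seq_dist_head_tail [leRHS]seq_dist_head_tail /=.
by rewrite lerD2l ler_wpM2l//; exact: (IH (Defs.shift x) (Defs.shift y)).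
Qed.

Lemma measurable_truncate k : measurable_fun setT (truncate k : BX -> BX).
Proof.
apply: (@measurability _ _ _ BX _ _ (@open X)) => //.
move=> _ [W /metric_openP oW <-]; rewrite setTI; apply: open_borel.
apply/metric_openP => x /oW[e e0 eW]; exists e => // y xy; apply: eW.
exact: le_lt_trans (seq_dist_truncate k x y) xy.
Qed.

Lemma cylinder_truncate k h (t : R) : measurable_fun setT h ->
  cylinder k [set x | t <= h (truncate k x)].
Proof.
move=> mh; split.
  exact: (measurable_superlevel t (measurableT_comp mh (measurable_truncate k))).
move=> x y xy; rewrite /= (_ : truncate k x = truncate k y)//.
by apply/funext => i; rewrite /truncate; case: ifP => // /xy.
Qed.

(** Truncating to finitely many coordinates and then quantizing turns h, up to a
    small uniform error, into a combination of indicators of cylinders. *)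
Lemma local_fun_cvg (m : nat -> finite_borel_measure R X) (nu : finite_borel_measure R X) h :
  (forall n, m n setT = 1%E) -> nu setT = 1%E ->
  (forall A, cylinders A -> \int[m n]_x \1_A x @[n --> \oo] --> \int[nu]_x \1_A x) ->
  measurable_fun setT h -> (forall x, 0 <= h x <= 1) ->
  (forall e : R, 0 < e -> exists k, forall x y,
    (forall i, (i < k)%N -> x i = y i) -> `|h x - h y| <= e) ->
  \int[m n]_x h x @[n --> \oo] --> \int[nu]_x h x.
Proof.
move=> m1 nu1 cA mh h01 loc; apply/cvgrPdist_le => e e0.
have bh : bmeas h.
  by split => //; exists 1 => x; have /andP[? ?] := h01 x; rewrite ger0_norm.
have e8 : 0 < e / 8 by rewrite divr_gt0.
have [k hk] := loc _ e8.
have [q qe] : exists q, q.+1%:R^-1 < e / 8.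
  by have [q _ /(_ q (leqnn q))] := near_infty_natSinv_lt (PosNum e8); exists q.
pose ht : BX -> R := h \o truncate k.
pose g := quantize q.+1 ht.
have mht : measurable_fun setT ht := measurableT_comp mh (measurable_truncate k).
have bg : @bmeas _ BX R g by exact: bmeas_quantize.
have hg x : `|h x - g x| <= e / 4.
  rewrite -(subrKA (h (truncate k x))); apply: le_trans (ler_normD _ _) _.
  have h1 : `|h x - h (truncate k x)| <= e / 8.
    by apply: hk => i ik; rewrite truncate_agree.
  have h2 : `|h (truncate k x) - g x| <= e / 8.
    apply: le_trans (ltW qe); apply: (quantize_dist (g := ht)) => // z.
    exact: h01.
  by move: h1 h2; lra.
have diff (w : finite_borel_measure R X) : w setT = 1%E ->
    `|\int[w]_x h x - \int[w]_x g x| <= e / 4.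
  move=> w1; rewrite -RintB//; apply: (le_trans (le_normr_Rintegral _ _)) => //.
    by apply: bmeas_integrable; exact: bmeasB.
  have Iw : \int[w]_x (e / 4) = e / 4.
    by rewrite Rintegral_cst// [X in _ * X](_ : _ = 1) ?mulr1// [X in fine X]w1.
  rewrite -[leRHS]Iw; apply: Rint_le => //; last exact: bmeas_cst.
  split; last by exists (e / 4) => x; rewrite normr_id.
  by apply: measurableT_comp => //; exact: measurable_funB bh.1 bg.1.
have cg : \int[m n]_x g x @[n --> \oo] --> \int[nu]_x g x.
  pose A i := [set y : X | i.+1%:R * q.+1%:R^-1 <= h (truncate k y)].
  have cyA i : cylinders (A i) by exists k; exact: cylinder_truncate.
  have bA i : @bmeas _ BX R \1_(A i) by have [? [mA _]] := cyA i; exact: bmeas_indic.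
  have gE (w : finite_borel_measure R X) :
      \int[w]_x g x = \sum_(i < q.+1) q.+1%:R^-1 * \int[w]_x \1_(A i) x.
    rewrite (@Rint_sum _ _ _ w q.+1 (fun i x => q.+1%:R^-1 * \1_(A i) x)).
      by apply: eq_bigr => i _; rewrite RintZ.
    by move=> i; exact: bmeasZ.
  under eq_fun do rewrite gE; rewrite gE.
  move: (q.+1%:R^-1 : R) => c; elim: (q.+1) => [|r IH].
    by rewrite big_ord0; under eq_fun do rewrite big_ord0; exact: cvg_cst.
  rewrite big_ord_recr/= (_ : (fun n => _) = fun n =>
      \sum_(i < r) c * \int[m n]_x \1_(A i) x + c * \int[m n]_x \1_(A r) x); last first.
    by apply/funext => n; rewrite big_ord_recr.
  by apply: cvgD => //; apply: cvgM; [exact: cvg_cst|exact: cA].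
have e4 : 0 < e / 4 by rewrite divr_gt0.
have /cvgrPdist_le/(_ _ e4) := cg; apply: filterS => n.
have := diff _ (m1 n); have := diff _ nu1.
rewrite !ler_norml => /andP[? ?] /andP[? ?] /andP[? ?].
by apply/andP; split; lra.
Qed.

Variables (p : probability BE R) (f : X -> R) (alpha Cf : R).
Hypotheses (sepE : separable E) (bf : @bmeas _ BX R f).
Hypothesis L1 : forall x, ruelle p f (fun=> 1) x = 1.
Hypotheses (alpha0 : 0 < alpha) (distortion : distortion_constant alpha f Cf).

Local Notation L := (ruelle p f : (X -> R) -> X -> R).

Lemma indic_itv (A : set X) x : 0 <= (\1_A x : R) <= 1.
Proof. by rewrite indicE; case: (_ \in _); rewrite ?lexx ?ler01. Qed.

Lemma cylinder_bmeas A : cylinders A -> @bmeas _ BX R \1_A.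
Proof. by move=> [k [mA _]]; exact: bmeas_indic. Qed.

Lemma cylinder_cvg A x : cylinders A ->
  iter n L \1_A x @[n --> \oo] --> ruelle_lim p f \1_A.
Proof.
move=> cA; have [k Ak] := cA.
apply: (word_lip_cvg sepE bf L1 alpha0 distortion x (cylinder_bmeas cA) (indic_itv A)).
exact: cylinder_word_lip Ak.
Qed.

Lemma iter_ruelleD n phi psi x : bmeas phi -> bmeas psi ->
  iter n L (fun y => phi y + psi y) x = iter n L phi x + iter n L psi x.
Proof.
move=> bphi bpsi; elim: n x => //= n IH x.
transitivity (L (fun y => iter n L phi y + iter n L psi y) x).
  by congr (ruelle p f _ x); apply/funext => y; exact: IH.
by rewrite ruelleD//; exact: bmeas_iter_ruelle.
Qed.

Lemma ruelle_limU A B : cylinders A -> cylinders B -> A `&` B = set0 ->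
  ruelle_lim p f \1_(A `|` B) = ruelle_lim p f \1_A + ruelle_lim p f \1_B.
Proof.
move=> cA cB AB; apply: cvg_lim => //.
rewrite (_ : \1_(A `|` B) = (fun y => \1_A y + \1_B y)); last first.
  apply/funext => y; rewrite !indicE in_setU.
  have [/set_mem Ay|] := boolP (y \in A); have [/set_mem By|] := boolP (y \in B);
    rewrite ?addr0 ?add0r//.
  by have : (A `&` B) y by []; rewrite AB.
rewrite (_ : (fun n => _) = (fun n => iter n L \1_A point + iter n L \1_B point)).
  by apply: cvgD; exact: cylinder_cvg.
by apply/funext => n; rewrite iter_ruelleD//; exact: cylinder_bmeas.
Qed.

(** The limiting masses of cylinders are additive as limits of additive functions,
    and continuous at the empty set by persistent_bigcap. *)
Lemma limit_probability : exists nu : probability BX R,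
  forall A, cylinders A -> nu A = (ruelle_lim p f \1_A)%:E.
Proof.
have [|||nu0 nu0E] := @algebra_extension _ (@cylinder_space R E) R
    (fun A => ruelle_lim p f \1_A).
- move=> A cA; apply: ruelle_lim_ge0 => //; first exact: cylinder_bmeas.
  by apply/cvg_ex; eexists; exact: cylinder_cvg.
- exact: ruelle_limU.
- move=> F e cF Fdec e0 eF.
  apply: (persistent_bigcap sepE bf L1 alpha0 distortion) => //.
  exists 1, e; split=> // n; split=> //.
  + exact: (cylinder_bmeas (cF n)).
  + by have [k Fk] : cylinders (F n) := cF n; exists k; exact: cylinder_word_lip Fk.
  + exact: indic_itv.
  + move=> x; rewrite !indicE ler_nat.
    by have [/set_mem/Fdec/mem_set->|] := boolP (x \in F n.+1).
pose nu1 : set BX -> \bar R := nu0.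
have m0 : nu1 set0 = 0%E by exact: measure0.
have mge0 A : (0 <= nu1 A)%E by exact: measure_ge0.
have msa : semi_sigma_additive nu1.
  move=> F mF tF mUF; rewrite /nu1.
  have mG B : (@measurable _ BX) B -> <<s cylinders >> B by rewrite borel_cylinders.
  by apply: (@measure_semi_sigma_additive _ _ _ nu0) => // [i|]; exact: mG.
have m1 : nu1 setT = 1%E.
  rewrite /nu1 nu0E; last exact: cylindersT.
  congr (_%:E); apply: cvg_lim => //.
  rewrite (_ : (fun n => _) = fun=> 1); first exact: cvg_cst.
  apply/funext => n; apply/eqP; rewrite eq_le indicT andbC.
  by apply: (iter_ruelle_itv sepE bf L1 n point (bmeas_cst BX (1 : R))) => y; rewrite lexx.
have [M1 M1E] : exists M1 : {measure set BX -> \bar R}, forall A, M1 A = nu1 A.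
  pose M : {measure set BX -> \bar R} :=
    HB.pack nu1 (isMeasure.Build _ _ _ nu1 m0 mge0 msa).
  by exists M.
have M11 : M1 setT = 1%E by rewrite M1E.
exists (mnormalize M1 (dirac (point : BX))) => A cA.
rewrite /= /mnormalize M11 onee_eq0 /= M1E invr1 mule1; exact: nu0E.
Qed.

(** One application of the Harnack inequality: if x and y share enough coordinates,
    then bx and by lie in A for the same letters b, and their weights nearly
    agree. *)
Lemma ruelle_cylinder_local A : cylinders A -> forall e : R, 0 < e ->
  exists k, forall x y, (forall i, (i < k)%N -> x i = y i) ->
    `|L \1_A x - L \1_A y| <= e.
Proof.
move=> cA e e0; have [Cf0 _] := distortion; have [k [_ Ak]] := cA.
have bA := cylinder_bmeas cA.
have [n [kn ne]] : exists n, (k <= n)%N /\ Cf * (2^-1 ^+ n) `^ alpha <= e.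
  near \oo => n; exists n; split; first by near: n; exact: nbhs_infty_ge.
  rewrite mulrC -ler_pdivlMr//; near: n; apply: (cvgr_le _ (pow2_cvg0 alpha0)).
  by rewrite divr_gt0.
exists n.
have key x y : (forall i, (i < n)%N -> x i = y i) -> L \1_A x <= L \1_A y + e.
  move=> xy; set delta := mdist x y `^ alpha.
  have d0 : 0 <= delta by exact: powR_ge0.
  have : 1 * iter 1 L \1_A x <= (1 + Cf * delta) * iter 1 L \1_A y.
    apply: iter_ruelle_le => // s; rewrite mul1r mulrA.
    have -> : \1_A (sconcat s x) = \1_A (sconcat s y) :> R.
      have agree z z' : (forall i, (i < n)%N -> z i = z' i) ->
          forall i, (i < k)%N -> sconcat s z i = sconcat s z' i.
        move=> zz' i ik; case: (s) => -[|b [|? ?]]//= _.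
        by case: i ik => // i ik; apply: zz'; exact: leq_trans (ltnW ik) kn.
      rewrite !indicE; congr ((nat_of_bool _)%:R).
      apply/idP/idP => /set_mem/Ak h; apply/mem_set/h/agree => // i ni.
      by rewrite xy.
    by rewrite ler_wpM2r//; exact: word_weight_le.
  rewrite mul1r => /le_trans; apply; rewrite mulrDl mul1r lerD2l.
  have /andP[L0 L1'] := ruelle_itv sepE bf L1 y bA (indic_itv A).
  apply: le_trans ne; apply: (@le_trans _ _ (Cf * delta)).
    by rewrite ler_piMr// mulr_ge0// ltW.
  rewrite ler_wpM2l ?(ltW Cf0)//; apply: ge0_ler_powR; rewrite ?nnegrE.
  - exact: ltW.
  - exact: mdist_ge0.
  - exact: exprn_ge0.
  - exact: seq_dist_agree.
move=> x y xy; have := key x y xy; have := key y x (fun i ni => esym (xy i ni)).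
by rewrite ler_norml => ? ?; apply/andP; split; lra.
Unshelve. all: end_near. Qed.

(** The measures P^n of a Dirac mass converge to nu on cylinders, hence also on
    L 1_A, which is not a cylinder function but is a uniform limit of such; and
    integrating L 1_A only shifts the sequence by one step. *)
Lemma limit_stationary (nu : probability BX R) :
  (forall A, cylinders A -> nu A = (ruelle_lim p f \1_A)%:E) ->
  forall A, cylinders A -> \int[nu]_x L \1_A x = \int[nu]_x \1_A x.
Proof.
move=> nuE A cA; have [P dual] := ruelle_dual_exists sepE bf L1.
pose m n : finite_borel_measure R X := iter n P (dirac (point : BX)).
have mE n phi : bmeas phi -> \int[m n]_x phi x = iter n L phi point.
  by move=> bphi; rewrite (dual_iter sepE bf n _ dual)// Rint_dirac//; exact: bmeas_iter_ruelle.
have nuI B : cylinders B -> \int[nu]_x \1_B x = ruelle_lim p f \1_B.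
  move=> cB; apply: EFin_inj; rewrite Rint_indic; first exact: nuE.
  by have [k []] := cB.
have bA := cylinder_bmeas cA.
have cmL : \int[m n]_x L \1_A x @[n --> \oo] --> \int[nu]_x L \1_A x.
  apply: local_fun_cvg.
  - move=> n; rewrite -Rint_indic// mE; last exact: bmeas_indic.
    congr (_%:E); apply/eqP; rewrite eq_le indicT andbC.
    by apply: (iter_ruelle_itv sepE bf L1 n point (bmeas_cst BX (1 : R))) => y; rewrite lexx.
  - exact: probability_setT.
  - move=> B cB; rewrite nuI// (_ : (fun n => _) = (fun n => iter n L \1_B point)).
      exact: cylinder_cvg.
    by apply/funext => n; rewrite mE//; exact: cylinder_bmeas.
  - by have [] := bmeas_ruelle p sepE bf bA.
  - by move=> x; apply: ruelle_itv => //; exact: indic_itv.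
  - exact: ruelle_cylinder_local.
rewrite nuI//; apply: (cvg_unique _ cmL) => //.
rewrite (_ : (fun n => _) = (fun n => iter n.+1 L \1_A point)); last first.
  by apply/funext => n; rewrite mE ?iterSr//; exact: bmeas_ruelle.
by have := cylinder_cvg point cA; rewrite -(cvg_shiftS (fun n => iter n L \1_A point)).
Qed.

End stationary_measure.

(** * Test functions *)

Section test_functions.
Context {R : realType} {E : completeMetricType R}.
Local Notation X := (sequence_space E).
Local Notation BX := (borel X).
Implicit Types (x y : X) (g : X -> R).

Lemma bounded_funP g : bounded_fun g <-> exists M : R, forall x, `|g x| <= M.
Proof.
split=> [[M [_ gM]]|[M gM]]; first by exists (M + 1) => x; apply: gM; rewrite ?ltrDl.
by exists M; split; [exact: num_real|move=> N MN x _; exact: le_trans (ltW MN)].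
Qed.

Lemma Cb_bmeas g : Cb g -> @bmeas _ BX R g.
Proof. by move=> [cg /bounded_funP bg]; split => //; exact: continuous_borel_fun. Qed.

Lemma holder_continuous (alpha K : R) g : 0 < alpha -> 0 <= K ->
  (forall x y, `|g x - g y| <= K * mdist x y `^ alpha) -> continuous g.
Proof.
move=> alpha0 K0 gK x U /nbhs_ballP[e /= e0 eU].
suff : nbhs x (g @^-1` U) by [].
have K1 : 0 < K + 1 by rewrite ltr_wpDl.
have eK : 0 < e / (K + 1) by rewrite divr_gt0.
apply/nbhs_ballP; exists ((e / (K + 1)) `^ alpha^-1); first by rewrite /= powR_gt0.
move=> y; rewrite ballEmdist/= => xy; apply: eU; apply: le_lt_trans (gK x y) _.
have dle : mdist x y `^ alpha <= e / (K + 1).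
  have eKE : e / (K + 1) = ((e / (K + 1)) `^ alpha^-1) `^ alpha.
    by rewrite -powRrM mulVf ?lt0r_neq0// powRr1// ltW.
  rewrite [leRHS]eKE; apply: ge0_ler_powR;
    by rewrite ?nnegrE ?powR_ge0 ?mdist_ge0 ?(ltW alpha0) ?(ltW xy).
apply: le_lt_trans (ler_wpM2l K0 dle) _.
by rewrite mulrA ltr_pdivrMr// mulrC ltr_pM2l// ltrDl ltr01.
Qed.

(** For h the distance to the complement of W, min 1 (n * h) is Lipschitz, is 0 off
    W, and is eventually 1 at each point of W, where h is positive. *)
Lemma open_indic_lim (W : set X) : open W -> exists phi : nat -> X -> R,
  (forall n, Cb (phi n)) /\ (forall n x, 0 <= phi n x <= 1) /\
  forall x, phi n x @[n --> \oo] --> (\1_W x : R).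
Proof.
move=> oW; have [[y0 Wy0]|WT] := pselect (exists y0, ~ W y0); last first.
  exists (fun _ _ => 1); split=> [_|].
    split.
      by apply: (@holder_continuous 1 0) => // x y; rewrite subrr normr0 mul0r.
    by apply/bounded_funP; exists 1 => x; rewrite normr1.
  split=> [_ x|x]; first by rewrite ler01 lexx.
  rewrite indicE mem_set; first exact: cvg_cst.
  by apply: contrapT => Wx; apply: WT; exists x.
pose D x := [set mdist x y | y in ~` W].
have D0 x : lbound (D x) 0 by move=> _ [y _ <-]; exact: mdist_ge0.
have Dinf x : has_inf (D x) by split; [exists (mdist x y0), y0|exists 0].
pose h x := inf (D x).
have h0 x : 0 <= h x by apply: lb_le_inf; [exact: (Dinf x).1|exact: D0].
have hle x y : ~ W y -> h x <= mdist x y.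
  by move=> Wy; apply: ge_inf; [exact: (Dinf x).2|exists y].
have hlip x y : h x <= h y + mdist x y.
  rewrite -lerBlDr; apply: lb_le_inf; first exact: (Dinf y).1.
  move=> _ [z Wz <-]; rewrite lerBlDr (le_trans (hle x z Wz))//.
  by rewrite addrC metric_triangle.
exists (fun n x => Num.min 1 (n%:R * h x)); split=> [n|].
  split; last first.
    apply/bounded_funP; exists 1 => x; rewrite ger0_norm ?ge_min ?lexx//.
    by rewrite le_min ler01 mulr_ge0.
  apply: (@holder_continuous 1 n%:R) => // x y; rewrite powRr1 ?mdist_ge0//.
  have key x' y' : Num.min 1 (n%:R * h x') <= Num.min 1 (n%:R * h y') + n%:R * mdist x' y'.
    have nd : 0 <= n%:R * mdist x' y' by rewrite mulr_ge0// mdist_ge0.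
    have : n%:R * h x' <= n%:R * h y' + n%:R * mdist x' y' by rewrite -mulrDr ler_wpM2l.
    rewrite /Order.min; case: ltP => h1; case: ltP => h2; lra.
  have := key x y; have := key y x; rewrite (metric_sym y x) ler_norml => ? ?.
  by apply/andP; split; lra.
split=> [n x|x]; first by rewrite le_min ler01 mulr_ge0//= ge_min lexx.
rewrite indicE; have [/set_mem Wx|/negP nWx] := boolP (x \in W); last first.
  have -> : h x = 0.
    apply/eqP; rewrite eq_le h0 andbT -(mdistxx x) hle//.
    by move=> Wx; apply: nWx; exact: mem_set.
  under eq_fun do rewrite mulr0 min_r ?ler01//; exact: cvg_cst.
have [e e0 eW] := (metric_openP W).1 oW x Wx.
have he : e <= h x.
  apply: lb_le_inf; first exact: (Dinf x).1.
  by move=> _ [y Wy <-]; rewrite leNgt; apply/negP => /eW.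
apply: cvg_near_cst; near=> n; apply: min_l.
apply: (@le_trans _ _ (n%:R * e)); last by rewrite ler_wpM2l.
rewrite -ler_pdivrMr// div1r; near: n; exact: nbhs_infty_ger.
Unshelve. all: end_near. Qed.

Lemma Cb_measure_eq (m1 m2 : finite_borel_measure R X) :
  (forall g, Cb g -> (\int[m1]_x (g x)%:E = \int[m2]_x (g x)%:E)%E) -> measure_eq m1 m2.
Proof.
move=> m12 A mA.
apply: (@measure_unique _ R BX (@open X) (fun=> setT) _ _ _ _ m1 m2) => //.
- by move=> U V; exact: openI.
- by move=> _; exact: openT.
- by rewrite bigcup_const.
- move=> W oW; have [phi [Cphi [phi01 phiW]]] := open_indic_lim oW.
  have mW : measurable (W : set BX) by exact: open_borel.
  have cvgm (m : finite_borel_measure R X) :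
      \int[m]_x phi n x @[n --> \oo] --> \int[m]_x \1_W x.
    apply: (Rint_bounded_cvg m (M := 1) (u := phi) _ _ phiW).2.
    + by move=> n; have [] := Cb_bmeas (Cphi n).
    + by move=> n x; have /andP[? ?] := phi01 n x; rewrite ger0_norm.
  apply: etrans (esym (Rint_indic m1 mW)) _.
  apply: etrans _ (Rint_indic m2 mW); congr (_%:E).
  apply: (cvg_unique _ (cvgm m1)) => //.
  rewrite (_ : (fun n => _) = fun n => \int[m2]_x phi n x); first exact: cvgm.
  by apply/funext => n; rewrite /Rintegral m12.
- by move=> _; rewrite -ge0_fin_numE// fin_num_measure.
Qed.

Lemma measure_eq_Rintegral (m1 m2 : finite_borel_measure R X) g : measure_eq m1 m2 ->
  \int[m1]_x g x = \int[m2]_x g x.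
Proof.
by move=> m12; rewrite /Rintegral (eq_measure_integral m2)// => A mA _; exact: m12.
Qed.

Lemma lip_const_bar_lip (alpha Cf : R) g : 0 < Cf ->
  (lip_const (bar_dist alpha Cf) g <= 1)%E <-> bar_lip alpha Cf 1 g.
Proof.
move=> Cf0.
have D0 x y : x <> y -> 0 < bar_dist alpha Cf x y.
  move=> /eqP xy; rewrite lt_min ltr01 !mulr_gt0// powR_gt0// mdist_gt0//.
split=> [gle x y|lg].
  have [->|xy] := pselect (x = y).
    by rewrite mul1r lerDl le_min ler01 !mulr_ge0 ?powR_ge0// ltW.
  rewrite mul1r -lerBlDl; apply: le_trans (ler_norm _) _.
  rewrite -[leRHS]mul1r -ler_pdivrMr ?D0// -lee_fin; apply: le_trans gle.
  by apply: ereal_sup_ubound; exists (x, y).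
apply: ge_ereal_sup => _ [[x y] /= xy <-].
rewrite lee_fin ler_pdivrMr ?D0// ler_norml.
have := lg x y; have := lg y x; rewrite bar_dist_sym.
by move=> ? ?; apply/andP; split; lra.
Qed.

End test_functions.

(** * The dual Markov operator *)

Section dual_operator.
Context {R : realType} {E : completeMetricType R}.
Local Notation X := (sequence_space E).
Local Notation BX := (borel X).
Local Notation BE := (borel E).
Implicit Types (x y : X) (phi g : BX -> R) (mu : finite_borel_measure R X).
Variables (p : probability BE R) (f : X -> R) (alpha Cf : R).
Hypotheses (sepE : separable E) (bf : @bmeas _ BX R f).
Hypothesis L1 : forall x, ruelle p f (fun=> 1) x = 1.
Hypotheses (alpha0 : 0 < alpha) (distortion : distortion_constant alpha f Cf).

Local Notation L := (ruelle p f : (X -> R) -> X -> R).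

Lemma ruelle_dual_bmeas (P : finite_borel_measure R X -> finite_borel_measure R X) :
  (forall mu phi, bmeas phi -> \int[P mu]_x phi x = \int[mu]_x L phi x) ->
  is_ruelle_dual p f P.
Proof.
move=> dual mu phi /Cb_bmeas bphi.
rewrite -(EFin_Rintegral _ bphi) dual// EFin_Rintegral//; exact: bmeas_ruelle.
Qed.

Variable P : finite_borel_measure R X -> finite_borel_measure R X.
Hypothesis dualP : is_ruelle_dual p f P.

(** A dual given on bounded continuous functions only is the same, up to equality on
    Borel sets, as the one constructed on bounded measurable functions. *)
Lemma dual_bmeas mu phi : bmeas phi -> \int[P mu]_x phi x = \int[mu]_x L phi x.
Proof.
move=> bphi; have [P0 dual0] := ruelle_dual_exists sepE bf L1.
rewrite -dual0//; apply: measure_eq_Rintegral; apply: Cb_measure_eq => g Cg.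
by rewrite dualP// (ruelle_dual_bmeas dual0).
Qed.

Lemma dual_indic mu (A : set X) : measurable (A : set BX) ->
  P mu A = (\int[mu]_x L \1_A x)%:E.
Proof.
move=> mA; rewrite -dual_bmeas; last exact: bmeas_indic.
exact: (esym (Rint_indic (P mu) mA)).
Qed.

Lemma Rintegral_comb (l1 l2 : {nonneg R}) (mu1 mu2 mu : finite_borel_measure R X) g :
  (forall A, measurable A -> mu A = (l1%:num%:E * mu1 A + l2%:num%:E * mu2 A)%E) ->
  bmeas g -> (forall x, 0 <= g x) ->
  \int[mu]_x g x = l1%:num * \int[mu1]_x g x + l2%:num * \int[mu2]_x g x.
Proof.
move=> muE bg g0; have [mg _] := bg.
have mgE : measurable_fun setT (EFin \o g) by exact/measurable_EFinP.
apply: EFin_inj; rewrite EFinD !EFinM !EFin_Rintegral//.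
rewrite (eq_measure_integral (measure_add (mscale l1 mu1) (mscale l2 mu2))).
  rewrite ge0_integral_measure_add//; last by move=> x _; rewrite lee_fin.
  by rewrite !ge0_integral_mscale// => x _; rewrite lee_fin.
move=> A mA _; apply: etrans (muE A mA) _.
by rewrite /measure_add/= /msum 2!big_ord_recl big_ord0/= adde0.
Qed.

Lemma dual_markov : markov_operator P.
Proof.
split=> [l1 l2 mu1 mu2 mu muE A mA|mu].
  have bA : @bmeas _ BX R \1_A by exact: bmeas_indic.
  rewrite !dual_indic// (Rintegral_comb muE).
  - by rewrite EFinD !EFinM.
  - exact: bmeas_ruelle.
  - by move=> x; have /andP[] := ruelle_itv sepE bf L1 x bA (indic_itv A).
rewrite dual_indic// -(Rint_indic mu measurableT); congr (_%:E).
apply: eq_Rintegral => x _; rewrite indicT; exact: ruelle_cst.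
Qed.

Lemma stationary_iter mu n phi : stationary P mu -> bmeas phi ->
  \int[mu]_x phi x = \int[mu]_x iter n L phi x.
Proof.
move=> st bphi; elim: n => // n ->; rewrite [iter n.+1 L _]iterS -dual_bmeas.
  by apply: measure_eq_Rintegral => A mA; rewrite st.
exact: bmeas_iter_ruelle.
Qed.

Lemma wasserstein_ge0 mu nu : (0 <= wasserstein alpha Cf mu nu)%E.
Proof.
have [Cf0 _] := distortion.
apply: ereal_sup_ubound; exists (fun=> 0) => /=; last first.
  by rewrite !integral0 sube0.
apply/lip_const_bar_lip => // x y.
by rewrite add0r mul1r le_min ler01 !mulr_ge0 ?powR_ge0// ltW.
Qed.

Lemma bar_lip_bmeas g : bar_lip alpha Cf 1 g -> @bmeas _ BX R g.
Proof.
move=> lg; have [Cf0 _] := distortion.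
apply: Cb_bmeas; split.
  apply: (@holder_continuous _ _ alpha (4 * Cf)) => //; first by rewrite mulr_ge0// ltW.
  move=> x y; rewrite ler_norml.
  have Dle : bar_dist alpha Cf x y <= 4 * Cf * mdist x y `^ alpha.
    by rewrite ge_min lexx orbT.
  have := lg x y; have := lg y x; rewrite bar_dist_sym !mul1r => ? ?.
  by apply/andP; split; lra.
apply/bounded_funP; exists (`|g point| + 1) => x.
have := bar_dist_le1 alpha Cf x point.
have := lg x point; have := lg point x; rewrite bar_dist_sym !mul1r => ? ? ?.
have := ler_norm (g point); have := ler_norm (- g point); rewrite normrN => ? ?.
by rewrite ler_norml; apply/andP; split; lra.
Qed.

(** Duality moves P^n to the test function, where L^n g is within C s^n of a
    constant l; the factor 2 compares both integrals to l. *)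
Lemma wasserstein_rate : exists C s : R, [/\ 0 < C, 0 < s < 1 &
  forall mu nu : probability BX R, stationary P nu -> forall n,
    (wasserstein alpha Cf (iter n P mu) nu <= (C * s ^+ n)%:E)%E].
Proof.
have [Cf0 _] := distortion.
have [C [s [C0 s01 lim]]] := iter_ruelle_limit sepE bf L1 alpha0 distortion.
exists (2 * C), s; split=> //; first by rewrite mulr_gt0.
move=> mu nu st n; apply: ge_ereal_sup => _ [g /= /lip_const_bar_lip lg <-].
have {}lg := lg Cf0; have bg := bar_lip_bmeas lg.
have [l /(_ n) nl] := lim _ _ ler01 bg lg.
rewrite -!EFin_Rintegral// -EFinB lee_fin (dual_iter sepE bf _ _ dual_bmeas)//.
rewrite (stationary_iter n st bg).
have bn : @bmeas _ BX R (iter n L g) by exact: bmeas_iter_ruelle.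
have near (w : probability BX R) :
    l - C * s ^+ n <= \int[w]_x iter n L g x <= l + C * s ^+ n.
  have cst_int (r : R) : \int[w]_x r = r :> R.
    by rewrite Rintegral_cst// [X in fine X]probability_setT mulr1.
  rewrite -{1}(cst_int (l - C * s ^+ n)) -{1}(cst_int (l + C * s ^+ n)).
  apply/andP; split; apply: Rint_le => //; try exact: bmeas_cst.
    by move=> x; have := nl x; rewrite ler_norml mul1r => /andP[? ?]; lra.
  by move=> x; have := nl x; rewrite ler_norml mul1r => /andP[? ?]; lra.
have /andP[? ?] := near mu; have /andP[? ?] := near nu; lra.
Qed.

(** A stationary measure gives a cylinder A the integral of L^n 1_A for every n, and
    these functions converge boundedly to the constant mass of A. *)
Lemma stationary_unique (nu nu' : probability BX R) :
  (forall A, cylinders A -> nu A = (ruelle_lim p f \1_A)%:E) ->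
  stationary P nu' -> measure_eq nu' nu.
Proof.
move=> nuE st; apply: cylinders_measure_eq => A cA.
have bA := cylinder_bmeas cA; have [k [mA _]] := cA.
apply: etrans (esym (nuE A cA)); apply: etrans (esym (Rint_indic nu' mA)) _.
congr (_%:E).
have [|n x|x|_ cn] := Rint_bounded_cvg nu' (M := 1) (u := fun n => iter n L \1_A)
    (g := fun=> ruelle_lim p f \1_A).
- by move=> n; have [] := bmeas_iter_ruelle p sepE bf n bA.
- have /andP[? ?] := iter_ruelle_itv sepE bf L1 n x bA (indic_itv A).
  by rewrite ger0_norm.
- exact: (cylinder_cvg sepE bf L1 alpha0 distortion).
rewrite Rintegral_cst// [X in fine X]probability_setT mulr1 in cn.
apply: (cvg_unique _ _ cn) => //.
rewrite (_ : (fun n => _) = fun=> \int[nu']_x \1_A x); first exact: cvg_cst.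
by apply/funext => n; rewrite -stationary_iter.
Qed.

Lemma limit_probability_stationary (nu : probability BX R) :
  (forall A, cylinders A -> nu A = (ruelle_lim p f \1_A)%:E) -> stationary P nu.
Proof.
move=> nuE; apply: cylinders_measure_eq => A cA; have [k [mA _]] := cA.
rewrite dual_indic// (limit_stationary sepE bf L1 alpha0 distortion)//.
exact: Rint_indic.
Qed.

End dual_operator.

Theorem theorem6p6 (R : realType) (E : completeMetricType R)
    (sepE : separable E) (p : probability (borel E) R)
    (alpha : R) (alpha01 : 0 < alpha < 1)
    (f : sequence_space E -> R) (f_hol : Hol alpha f)
    (f_normalized : forall x, ruelle p f (fun=> 1) x = 1)
    (Cf : R) (Cf_distortion : distortion_constant alpha f Cf) :
  (exists P, is_ruelle_dual p f P) /\
  forall P : finite_borel_measure R (sequence_space E) ->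
             finite_borel_measure R (sequence_space E),
    is_ruelle_dual p f P ->
    [/\ markov_operator P,
        asymptotically_stable (wasserstein alpha Cf) P &
        exists nu : probability (borel (sequence_space E)) R,
          [/\ stationary P nu,
              (forall nu' : probability (borel (sequence_space E)) R,
                 stationary P nu' -> measure_eq nu' nu) &
              exists C s : R, [/\ 0 < C, 0 < s < 1 &
                forall (mu : probability (borel (sequence_space E)) R) (n : nat),
                  (wasserstein alpha Cf (iter n P mu) nu <= (C * s ^+ n)%:E)%E]]].
Proof.
have [Cbf _] := f_hol; have bf := Cb_bmeas Cbf.
have /andP[alpha0 _] := alpha01.
split.
  have [P dual] := ruelle_dual_exists sepE bf f_normalized.
  by exists P; exact: ruelle_dual_bmeas.
move=> P dualP.
have [nu nuE] := limit_probability sepE bf f_normalized alpha0 Cf_distortion.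
have st : stationary P nu.
  exact: (limit_probability_stationary sepE bf f_normalized alpha0 Cf_distortion dualP).
have [C [s [C0 s01 rate]]] :=
  wasserstein_rate sepE bf f_normalized alpha0 Cf_distortion dualP.
split.
- exact: (dual_markov sepE bf f_normalized dualP).
- exists nu; split=> // mu.
  have s_cvg : (C * s ^+ n)%:E @[n --> \oo] --> 0%E.
    apply: cvg_EFin; first exact: nearW.
    rewrite -[X in _ --> X](mulr0 C); apply: cvgM; first exact: cvg_cst.
    by apply: cvg_expr; have /andP[s0 s1] := s01; rewrite ger0_norm// ltW.
  apply: (squeeze_cvge _ (cvg_cst _) s_cvg); apply: nearW => n.
  by rewrite (wasserstein_ge0 Cf_distortion) rate.
- exists nu; split=> //.
    by move=> nu'; exact: (stationary_unique sepE bf f_normalized alpha0 Cf_distortion dualP).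
  by exists C, s; split=> // mu n; exact: rate.
Qed.
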